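(* Let $\kappa\in\mathbb{R}$. Every metric space that is a $\mathrm{Cycl}_4(\kappa)$ space is a $\mathrm{Cycl}_n(\kappa)$ space for all integers $n\geq 5$.
   Context: For $\kappa\in\mathbb{R}$, $M_\kappa^2$ is the complete, simply-connected, two-dimensional Riemannian manifold of constant Gaussian curvature $\kappa$, with distance function $d_\kappa$, and $D_\kappa$ is its diameter: $D_\kappa=\pi/\sqrt{\kappa}$ if $\kappa>0$, $D_\kappa=\infty$ if $\kappa\leq 0$. For integers $n\ge 1$ and $m$, $[m]_n$ denotes the class of $m$ in $\mathbb{Z}/n\mathbb{Z}$. Definition. For an integer $n\geq 4$, a metric space $(X,d_X)$ is a $\mathrm{Cycl}_n(\kappa)$ space if for any map $f:\mathbb{Z}/n\mathbb{Z}\to X$ with $\sum_{i\in\mathbb{Z}/n\mathbb{Z}}d_X(f(i),f(i+[1]_n))<2D_\kappa$ there exists a map $g:\mathbb{Z}/n\mathbb{Z}\to M_\kappa^2$ such that $d_\kappa(g(i),g(i+[1]_n))\leq d_X(f(i),f(i+[1]_n))$ for every $i$, and $d_\kappa(g(i),g(j))\geq d_X(f(i),f(j))$ for any $i,j$ with $j\neq i+[1]_n$ and $i\neq j+[1]_n$. *)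

(* Defs.v *)
From mathcomp Require Import all_boot all_order all_algebra.
From mathcomp Require Import all_classical all_reals all_analysis.
Set Implicit Arguments.
Unset Strict Implicit.
Unset Printing Implicit Defensive.
Import Order.TTheory GRing.Theory Num.Theory.
Local Open Scope ring_scope.

Definition dot (R : realType) (n : nat) (u v : 'rV[R]_n) : R :=
  \sum_(i < n) u 0 i * v 0 i.

(* Lorentzian form of signature (2, 1); the negative coordinate is number 0. *)
Definition lorentz (R : realType) (u v : 'rV[R]_3) : R :=
  - (u 0 0 * v 0 0) + \sum_(i < 2) u 0 (lift 0 i) * v 0 (lift 0 i).

(* For 1 <= x, the unique t >= 0 with (expR t + expR (- t)) / 2 = x. *)
Definition arcosh (R : realType) (x : R) : R := ln (x + Num.sqrt (x ^+ 2 - 1)).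

Definition sphere2 (R : realType) : Type := {u : 'rV[R]_3 | dot u u == 1}.

Definition hyperboloid2 (R : realType) : Type :=
  {u : 'rV[R]_3 | (lorentz u u == -1) && (0 < u 0 0)}.

Record distance_space (R : realType) := DistanceSpace {
  carrier :> Type;
  sdist : carrier -> carrier -> R }.

Definition euclidean_plane (R : realType) : distance_space R :=
  @DistanceSpace R 'rV[R]_2 (fun u v => Num.sqrt (dot (u - v) (u - v))).

(* For kappa > 0: the unit sphere with its angular metric divided by
   sqrt kappa, i.e. the intrinsic metric of the sphere of radius
   1 / sqrt kappa. *)
Definition scaled_sphere (R : realType) (kappa : R) : distance_space R :=
  @DistanceSpace R (sphere2 R)
    (fun u v => acos (dot (sval u) (sval v)) / Num.sqrt kappa).

(* For kappa < 0: the upper sheet of the hyperboloid, where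
   cosh (distance) = - lorentz u v, with its metric divided by
   sqrt (- kappa). *)
Definition scaled_hyperbolic (R : realType) (kappa : R) : distance_space R :=
  @DistanceSpace R (hyperboloid2 R)
    (fun u v => arcosh (- lorentz (sval u) (sval v)) / Num.sqrt (- kappa)).

(* The complete simply connected Riemannian surface of constant curvature
   kappa, with its Riemannian distance, in its standard realisation. *)
Definition model_space (R : realType) (kappa : R) : distance_space R :=
  if 0 < kappa then scaled_sphere kappa
  else if kappa < 0 then scaled_hyperbolic kappa
  else euclidean_plane R.

Definition model_diam (R : realType) (kappa : R) : \bar R :=
  if 0 < kappa then (pi / Num.sqrt kappa)%:E else +oo%E.

(* Meant for n >= 4; 'Z_n is Z/nZ only when n >= 2. *)
Definition cycl (R : realType) (n : nat) (kappa : R) (X : metricType R) :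
    Prop :=
  forall f : 'Z_n -> X,
    ((\sum_(i : 'Z_n) mdist (f i) (f (i + 1)%R))%R%:E
       < 2%:E * model_diam kappa)%E ->
    exists g : 'Z_n -> model_space kappa,
      (forall i : 'Z_n,
         sdist (g i) (g (i + 1)) <= mdist (f i) (f (i + 1))) /\
      (forall i j : 'Z_n, j <> i + 1 -> i <> j + 1 ->
         mdist (f i) (f j) <= sdist (g i) (g j)).

(* Main.v *)
(* By induction on the number of vertices, a closed polygon all of whose
   quadrilaterals (in cyclic order) have comparison quadrilaterals can be drawn
   in the model plane with the same sides and with diagonals at least as long.

   Cut the polygon into triangles with a common vertex, the apex, and develop
   them around it.  Replace the distances to the apex by the least function r
   above them for which the outer boundary of the development has no angle
   larger than pi.  By minimality, at each vertex either r is the original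
   distance or the boundary is straight.  A quadrilateral with a comparison
   figure cannot have a longer second diagonal than a convex planar one with
   the same sides and first diagonal, so the intrinsic distances of the
   developed cone dominate the original ones.

   If the total angle at the apex is at most pi, the cone is a planar convex
   polygon and we are done.  Otherwise the apex lies on a geodesic between its
   two neighbours; quadrilaterals in the cone have comparison quadrilaterals,
   so induction applies to the remaining vertices with the intrinsic distance
   of the cone, and the apex is put back on the side joining its neighbours. *)

Require Import Defs.
From mathcomp Require Import all_boot all_order all_algebra.
From mathcomp Require Import all_classical all_reals all_analysis.
From mathcomp Require Import ring lra zify.
Set Implicit Arguments.
Unset Strict Implicit.
Unset Printing Implicit Defensive.
Import Order.TTheory GRing.Theory Num.Theory.
Import numFieldNormedType.Exports.
Local Open Scope classical_set_scope.
Local Open Scope ring_scope.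

(** All curvatures are treated at once: distances enter through [vers], for which the law of cosines
    has a single form, and angles away from the apex enter only through [stewart] and [inward], as
    inequalities between lengths. The signs of sines require lengths below [hlen]; they all come
    from the one bound perimeter < 2 * [hlen], since the two ways round the polygon cannot both be
    long.

    Minimality of [r] matters because it leaves no vertex without information: on the obstacle the
    comparison quadrilateral applies, and off it the chain is a geodesic, where the triangle
    inequality suffices.

    The induction cannot stay inside the given metric space, because the wide case replaces its
    distances by those of a cone. Hence [polygon] records only ordered triples and cyclically
    ordered quadruples, which the cone inherits, and [unfolds] keeps sides exactly, so that the
    closing side of the smaller polygon has the right length to receive the apex. Sides of length
    zero away from the apex are contracted beforehand, because the angle formulas say nothing
    there. *)

(* A model plane of curvature [k = curv]: [vers x = (1 - cos (sqrt k * x)) / k],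
   read as [x ^+ 2 / 2] for [k = 0], and [sine x] is its derivative.  The bound
   [hlen] is the diameter for [k > 0] and an arbitrary number for [k <= 0].  In
   [tensegrity], [qoa], ..., [qab] are the values of [vers] on the distances of
   a quadrilateral whose diagonals cross, as witnessed by the linear dependency
   [lo * o + lc * c = la * a + lb * b] between its vertices: shortening the sides
   and lengthening one diagonal shortens the other one.  [between] is Stewart's
   theorem. *)
Record plane_geometry (R : realType) := PlaneGeometry {
  pt :> Type;
  pdist : pt -> pt -> R;
  curv : R;
  vers : R -> R;
  sine : R -> R;
  hlen : R;
  polar : R -> R -> pt;
  vers0 : vers 0 = 0;
  versN : forall x, vers (- x) = vers x;
  sineN : forall x, sine (- x) = - sine x;
  versD : forall x y,
    vers (x + y) = vers x + vers y - curv * vers x * vers y + sine x * sine y;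
  sineD : forall x y,
    sine (x + y) = sine x * (1 - curv * vers y) + (1 - curv * vers x) * sine y;
  sine_sqr : forall x, sine x ^+ 2 = vers x * (2 - curv * vers x);
  vers_lt : forall x y, 0 <= x -> x < y -> x + y < 2 * hlen -> vers x < vers y;
  vers_continuous : continuous vers;
  sine_gt0 : forall x, 0 < x -> x < hlen -> 0 < sine x;
  pdistC : forall a b, pdist a b = pdist b a;
  pdistxx : forall a, pdist a a = 0;
  pdist_triangle : forall b a c, pdist a c <= pdist a b + pdist b c;
  vers_pdist : forall a b c e,
    (vers (pdist a b) <= vers (pdist c e)) = (pdist a b <= pdist c e);
  polar0 : forall r phi psi, 0 <= r -> r <= hlen ->
    pdist (polar 0 phi) (polar r psi) = r;
  vers_polar : forall r r' phi psi, 0 <= r -> r <= hlen -> 0 <= r' -> r' <= hlen ->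
    vers (pdist (polar r phi) (polar r' psi)) =
    vers (r - r') + sine r * sine r' * (1 - cos (phi - psi));
  tensegrity : forall (o a c b : pt) (qoa qoc qob qac qcb qab lo la lc lb m : R),
    0 <= lo -> 0 <= la -> 0 <= lc -> 0 <= lb -> 0 < la + lb -> 0 < lo + lc ->
    0 <= qoc -> 0 <= qab ->
    lo + lc - la - lb = curv * m ->
    lc * qoc - la * qoa - lb * qob = m ->
    lo * qoc - la * qac - lb * qcb = m ->
    lo * qoa + lc * qac - lb * qab = m ->
    lo * qob + lc * qcb - la * qab = m ->
    vers (pdist o a) <= qoa -> vers (pdist o b) <= qob ->
    vers (pdist a c) <= qac -> vers (pdist c b) <= qcb ->
    qoc <= vers (pdist o c) ->
    vers (pdist a b) <= qab;
  between : forall (a b : pt) (x y : R), 0 < x -> 0 <= y -> x + y < hlen ->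
    pdist a b = x + y ->
    exists2 p, pdist p a = x /\ pdist p b = y &
      forall z, sine (x + y) * vers (pdist p z) =
        sine y * vers (pdist a z) + sine x * vers (pdist b z)
        - (sine y * vers x + sine x * vers y)
}.

(** * Trigonometry common to all curvatures, and the angle condition at a vertex *)

Section Trigonometry.
Variables (R : realType) (G : plane_geometry R).
Notation d := (@pdist R G).
Notation q := (vers G).
Notation S := (sine G).
Notation H := (hlen G).
Notation k := (curv G).
Implicit Types x y r s t : R.

Lemma sine0 : S 0 = 0.
Proof. by have := sineN G 0; rewrite oppr0; lra. Qed.

Lemma versB x y : q (x - y) = q x + q y - k * q x * q y - S x * S y.
Proof. by rewrite versD versN sineN; ring. Qed.

Lemma sineB x y : S (x - y) = S x * (1 - k * q y) - (1 - k * q x) * S y.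
Proof. by rewrite sineD versN sineN; ring. Qed.

Lemma vers_le x y : 0 <= x -> x <= y -> x + y < 2 * H -> q x <= q y.
Proof.
move=> x0; rewrite le_eqVlt => /orP[/eqP->//|xy] xyH.
exact/ltW/vers_lt.
Qed.

Lemma vers_inj x y : 0 <= x -> 0 <= y -> x + y < 2 * H -> q x = q y -> x = y.
Proof.
move=> x0 y0 xyH e; case: (ltgtP x y) => // l.
  by have := vers_lt x0 l xyH; rewrite e ltxx.
by rewrite addrC in xyH; have := vers_lt y0 l xyH; rewrite e ltxx.
Qed.

Lemma vers_norm x : q `|x| = q x.
Proof. by case: (ger0P x) => // _; rewrite versN. Qed.

Lemma vers_ge0 x : 0 <= x -> x < 2 * H -> 0 <= q x.
Proof. by move=> x0 xH; rewrite -(vers0 G); apply: vers_le; lra. Qed.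

Lemma sine_ge0 x : 0 <= x -> x < H -> 0 <= S x.
Proof.
rewrite le_eqVlt => /orP[/eqP<- _|x0 xH]; first by rewrite sine0.
exact/ltW/sine_gt0.
Qed.

(* For a broken line with sides [s], [t] whose vertices are at distances
   [r1], [r], [r2] from an apex, this has the sign of [pi] minus the angle at
   the middle vertex, measured as the sum of the angles of the two triangles. *)
Definition stewart s t r r1 r2 : R :=
  S (s + t) * q r + S t * q s + S s * q t - S t * q r1 - S s * q r2.

(** Three points on a line through the apex, with signed radii: the extremal position with which
    [stewart_le] compares other broken lines. *)
Lemma stewart_straight s t r : stewart s t r (r - s) (r + t) = 0.
Proof.
rewrite /stewart !versD !versN !sineN sineD; ring.
Qed.

Lemma stewart_sym s t r r1 r2 : stewart s t r r1 r2 = stewart t s r r2 r1.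
Proof. by rewrite /stewart [t + s]addrC; ring. Qed.

(** Only the term [S (s + t) * q r] moves with the middle radius. The [+ 1] in [e'] covers the case
    where its factor vanishes. *)
Lemma stewart_near s t r r1 r2 (e : R) : 0 < e -> exists2 dl, 0 < dl &
  forall y, `|r - y| < dl ->
    `|stewart s t r r1 r2 - stewart s t y r1 r2| < e.
Proof.
move=> e0; pose e' := e / (`|S (s + t)| + 1).
have n0 : 0 <= `|S (s + t)| by [].
have e'0 : 0 < e' by rewrite divr_gt0 //; lra.
have := @cvgr_dist_lt _ _ _ _ _ _ _ (@vers_continuous _ G r) e' e'0.
move=> nr; have [dl /= dl0 sub] := (nbhs_ballP _ _).1 (nr _); exists dl => // y ry.
have /= := sub y ry; set D := q r - q y => De.
rewrite (_ : _ - _ = S (s + t) * D); last by rewrite /stewart /D; ring.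
rewrite normrM (le_lt_trans (y := `|S (s + t)| * e')) //.
  by rewrite ler_wpM2l // ltW.
rewrite /e' mulrCA gtr_pMr //; rewrite ltr_pdivrMr; lra.
Qed.

(** Pulling the outer vertices towards the apex closes the angle in the middle. This is why
    convexity passes to pointwise infima and survives at the neighbours of a vertex that is
    lowered. *)
Lemma stewart_le s t r r1 r2 r1' r2' : 0 <= S s -> 0 <= S t ->
  q r1' <= q r1 -> q r2' <= q r2 -> stewart s t r r1 r2 <= stewart s t r r1' r2'.
Proof. rewrite /stewart; nra. Qed.

End Trigonometry.

(** * The least convex chain above an obstacle *)

(* A chain of points at positions [x i] along a closed polygon of length [L]
   through the apex; [o i] bounds from below the distance to the apex. *)
Record obstacle_data (R : realType) (G : plane_geometry R) (M : nat)
    (o s x : nat -> R) (L : R) : Prop := ObstacleData {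
  perim_lt : L < 2 * hlen G;
  obs_ge0 : forall i, (i <= M)%N -> 0 <= o i;
  obs_le : forall i, (i <= M)%N -> o i <= x i;
  obs_leC : forall i, (i <= M)%N -> o i <= L - x i;
  obs_first : o 0%N = x 0%N;
  obs_last : o M = L - x M;
  posS : forall i, (i < M)%N -> x i.+1 = x i + s i;
  side_gt0 : forall i, (i < M)%N -> 0 < s i;
  side_le : forall i, (i < M)%N -> s i <= o i + o i.+1
}.

(** The Lipschitz bounds, together with [side_le], are the triangle inequalities that let each
    triangle [r i], [s i], [r i.+1] be developed. These are the supersolutions of the obstacle
    problem. *)
Definition admissible (R : realType) (G : plane_geometry R) (M : nat)
    (o s r : nat -> R) : Prop :=
  [/\ forall i, (i <= M)%N -> o i <= r i,
      r 0%N = o 0%N, r M = o M,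
      forall i, (i < M)%N -> r i <= r i.+1 + s i /\ r i.+1 <= r i + s i &
      forall i, (i.+1 < M)%N ->
        0 <= stewart G (s i) (s i.+1) (r i.+1) (r i) (r i.+2)].

(** The Lipschitz bounds propagate from both ends, where [o] equals the position measured from that
    side. Together the two bounds give [r i < hlen G]. *)
Lemma admissible_le (R : realType) (G : plane_geometry R) M (o s x : nat -> R) (L : R) r i :
  obstacle_data G M o s x L -> admissible G M o s r -> (i <= M)%N -> r i <= x i /\ r i <= L - x i.
Proof.
move=> C; case=> _ r0 rM rs _ iM; split.
  elim: i iM => [|i IH] iM; first by rewrite r0 (obs_first C).
  have [_] := rs i iM; have := IH (ltnW iM); have := posS C iM; lra.
have : forall j, (j <= M)%N -> r (M - j)%N <= L - x (M - j)%N.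
  elim=> [|j IH] jM; first by rewrite subn0 rM (obs_last C).
  have h : (M - j.+1 < M)%N by lia.
  have e : (M - j.+1).+1 = (M - j)%N by lia.
  have [+ _] := rs _ h; have := posS C h; have := IH (ltnW jM); rewrite e; lra.
by move=> /(_ (M - i)%N); rewrite subKn //; apply; lia.
Qed.

(** A side is at most the way round through the apex, [x i + (L - x i.+1) = L - s i], hence at most
    half the perimeter. *)
Lemma side_lt (R : realType) (G : plane_geometry R) M (o s x : nat -> R) (L : R) i :
  obstacle_data G M o s x L -> (i < M)%N -> s i < hlen G.
Proof.
move=> C iM; have := side_le C iM; have := obs_le C (ltnW iM); have := obs_leC C iM.
by have := posS C iM; have := perim_lt C; lra.
Qed.

Lemma sine_side (R : realType) (G : plane_geometry R) M (o s x : nat -> R) (L : R) i :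
  obstacle_data G M o s x L -> (i < M)%N -> 0 < sine G (s i).
Proof. by move=> C iM; apply: sine_gt0; [apply: (side_gt0 C)|apply: (side_lt C)]. Qed.

(* The witness develops the polygon onto a segment traversed back and forth. *)
Lemma admissible_tent (R : realType) (G : plane_geometry R) M (o s x : nat -> R) (L : R) :
  obstacle_data G M o s x L -> exists r, admissible G M o s r.
Proof.
move=> C.
exists (fun i => Num.min (x i) (L - x i)); split.
- by move=> i iM; rewrite le_min (obs_le C) // (obs_leC C).
- have := obs_leC C (leq0n M); rewrite (obs_first C) => h; exact/min_idPl.
- have := obs_le C (leqnn M); rewrite (obs_last C) => h; exact/min_idPr.
- move=> i iM; have := posS C iM; have := side_gt0 C iM => s0 xs.
  by case: (leP (x i) (L - x i)); case: (leP (x i.+1) (L - x i.+1)); lra.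
- move=> i iM; have xs := posS C (ltnW iM); have xs' := posS C iM.
  have ss := side_gt0 C (ltnW iM); have ss' := side_gt0 C iM.
  have Ss := ltW (sine_side C (ltnW iM)); have Ss' := ltW (sine_side C iM).
  have h y : (y <= M)%N -> vers G (Num.min (x y) (L - x y)) <= vers G (x y) /\
      vers G (Num.min (x y) (L - x y)) <= vers G (L - x y).
    move=> yM; have := perim_lt C; have := obs_ge0 C yM; have := obs_le C yM; have := obs_leC C yM.
    clear -R => *; split; apply: vers_le; case: (leP (x y) (L - x y)); lra.
  (* One branch of the minimum is attained at the middle vertex. Continuing it on both sides gives a
     straight line, and the actual neighbours have no larger [vers]. *)
  have [c|c] := lerP (x i.+1) (L - x i.+1).
    rewrite -(stewart_straight G (s i) (s i.+1) (x i.+1)).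
    apply: stewart_le => //.
      by rewrite xs addrK; apply h; lia.
    by rewrite -xs'; apply h; lia.
  rewrite -(stewart_straight G (s i.+1) (s i) (L - x i.+1)) [leRHS]stewart_sym.
  apply: stewart_le => //.
    by rewrite (_ : _ - s i.+1 = L - x i.+2); [apply h; lia|rewrite xs'; ring].
  by rewrite (_ : _ + s i = L - x i); [apply h; lia|rewrite xs; ring].
Qed.

(** A strictly convex vertex is not at the lower end of its Lipschitz range. If [r2 = r + t], it
    lies on a geodesic from the apex to its neighbour, so the angle on that side is already pi and
    the total is at least pi. *)
Lemma stewart_gt0_lt (R : realType) (G : plane_geometry R) (s1 t r r1 r2 : R) : 0 < sine G s1 -> 0 < sine G t ->
  0 <= r1 -> `|r - s1| <= r1 -> r1 + `|r - s1| < 2 * hlen G ->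
  r2 = r + t -> 0 < stewart G s1 t r r1 r2 -> False.
Proof.
move=> s0 t0 r10 h1 h2 -> ; rewrite -(stewart_straight G s1 t r).
rewrite ltNge => /negP; apply; apply: stewart_le => //; try exact: ltW.
by rewrite -[vers G (r - s1)]vers_norm; apply: vers_le => //; rewrite addrC.
Qed.

(** Besides the obstacle, the lower bounds on [t] are the Lipschitz conditions that lowering one
    vertex could break; convexity at its neighbours only improves, by [stewart_le]. *)
Lemma admissible_replace (R : realType) (G : plane_geometry R) M (o s x : nat -> R) (L : R) r i t :
  obstacle_data G M o s x L -> admissible G M o s r -> (i.+1 < M)%N ->
  o i.+1 <= t -> t <= r i.+1 -> r i.+2 - s i.+1 <= t -> r i - s i <= t ->
  0 <= stewart G (s i) (s i.+1) t (r i) (r i.+2) ->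
  admissible G M o s (fun j => if j == i.+1 then t else r j).
Proof.
move=> C rP iM ot tr t2 t1 st; have [ro r_0 r_M rs r_st] := rP; split => //.
- by move=> j jM; case: eqP => [->|_] //; exact: ro.
- by case: eqP => // e; move: iM; rewrite e ltnn.
- move=> j jM; rewrite eqSS; case: (eqVneq j i.+1) => [->|n1].
    rewrite (gtn_eqF (ltnSn i)).
    by have [h _] := rs _ iM; move: tr t2 h; clear; split; lra.
  case: (eqVneq j i) => [->|n2]; last exact: rs.
  by have [_ h] := rs _ (ltnW iM); move: tr t1 h; clear; split; lra.
- move=> j jM; rewrite !eqSS.
  have qt : vers G t <= vers G (r i.+1).
    have := perim_lt C; have := obs_ge0 C (ltnW iM); have := admissible_le C rP (ltnW iM).
    by move: ot tr; clear => *; apply: vers_le; lra.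
  case: (eqVneq j i) => [->|n1].
    by rewrite ?eqxx (ltn_eqF (ltnSn i)) (gtn_eqF (ltnSn i)).
  have Sj := ltW (sine_side C (ltnW jM)); have Sj' := ltW (sine_side C jM).
  case: (eqVneq j i.+1) => [e|n2].
    rewrite (_ : (j.+1 == i) = false); last by rewrite e; lia.
    by apply: le_trans (r_st j jM) _; rewrite e in Sj Sj' *; exact: stewart_le.
  case: (eqVneq j.+1 i) => [e|n3]; last exact: r_st.
  by apply: le_trans (r_st j jM) _; rewrite e in Sj Sj' *; exact: stewart_le.
Qed.

Lemma admissible_lower (R : realType) (G : plane_geometry R) M (o s x : nat -> R) (L : R) r i :
  obstacle_data G M o s x L -> admissible G M o s r -> (i.+1 < M)%N -> o i.+1 < r i.+1 ->
  0 < stewart G (s i) (s i.+1) (r i.+1) (r i) (r i.+2) ->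
  exists2 t, t < r i.+1 & admissible G M o s (fun j => if j == i.+1 then t else r j).
Proof.
move=> C rP iM ol st; have [ro _ _ rs _] := rP; have iM' := ltnW iM.
have b1 : r i.+2 - s i.+1 < r i.+1.
  have : r i.+2 - s i.+1 <= r i.+1 by have [_] := rs _ iM; clear; lra.
  rewrite le_eqVlt => /orP[/eqP e|//].
  case: (@stewart_gt0_lt _ G (s i) (s i.+1) (r i.+1) (r i) (r i.+2));
    rewrite ?(sine_side C) //.
  - by apply: le_trans (ro _ _); [apply: (obs_ge0 C)|]; lia.
  - rewrite ler_norml; have [+ +] := rs _ iM'.
    by have := side_le C iM'; have := ro _ (ltnW iM'); have := ro _ iM'; clear; lra.
  - have := perim_lt C; have := side_le C iM'; have := ro _ (ltnW iM'); have := ro _ iM'.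
    have [+ _] := admissible_le C rP (ltnW iM'); have [_ +] := admissible_le C rP iM'.
    have := posS C iM'; have := side_gt0 C iM'; have := rs _ iM'; clear => *.
    by case: (ger0P (r i.+1 - s i)) => ?; lra.
  - by move: e; clear; lra.
have b2 : r i - s i < r i.+1.
  have : r i - s i <= r i.+1 by have [+ _] := rs _ iM'; clear; lra.
  rewrite le_eqVlt => /orP[/eqP e|//].
  case: (@stewart_gt0_lt _ G (s i.+1) (s i) (r i.+1) (r i.+2) (r i));
    rewrite ?(sine_side C) 1?stewart_sym //.
  - by apply: le_trans (ro _ _); [apply: (obs_ge0 C)|].
  - rewrite ler_norml; have [+ +] := rs _ iM.
    by have := side_le C iM; have := ro _ iM'; have := ro _ iM; clear; lra.
  - have := perim_lt C; have := side_le C iM; have := ro _ iM'; have := ro _ iM.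
    have [+ _] := admissible_le C rP iM'; have [_ +] := admissible_le C rP iM.
    have := posS C iM; have := side_gt0 C iM; have := rs _ iM; clear => *.
    by case: (ger0P (r i.+1 - s i.+1)) => ?; lra.
  - by move: e; clear; lra.
have [dl dl0 near] := stewart_near G (s i) (s i.+1) (r i.+1) (r i) (r i.+2) st.
(* The obstacle, the two Lipschitz bounds and the reach of continuity all lie strictly below
   [r i.+1], by [ol], [b1], [b2] and [dl0]; so does their maximum. *)
pose t := Num.max (o i.+1) (Num.max (Num.max (r i.+2 - s i.+1) (r i - s i)) (r i.+1 - dl / 2)).
have tlt : t < r i.+1.
  by rewrite /t !gt_max ol b1 b2 /=; move: dl0; clear; lra.
have [t1 t2 t3 t4] : [/\ o i.+1 <= t, r i.+2 - s i.+1 <= t, r i - s i <= t & r i.+1 - dl / 2 <= t].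
  by split; rewrite /t !le_max lexx ?orbT.
exists t => //; apply: (admissible_replace C rP) => //; first exact: ltW.
have /near : `|r i.+1 - t| < dl.
  by move: tlt t4 dl0; clear => *; rewrite ger0_norm; lra.
by rewrite ltr_norml; clear; lra.
Qed.

(** Perron's method: the pointwise infimum of the admissible functions is itself admissible, and at
    a vertex off the obstacle that is not straight it could still be lowered. *)
Lemma obstacle_solution (R : realType) (G : plane_geometry R) M (o s x : nat -> R) (L : R) :
  obstacle_data G M o s x L -> exists2 r, admissible G M o s r &
  forall i, (i.+1 < M)%N -> o i.+1 < r i.+1 ->
    stewart G (s i) (s i.+1) (r i.+1) (r i) (r i.+2) = 0.
Proof.
move=> C.
pose E i := [set r i | r in admissible G M o s]; pose r i := inf (E i).
have LH' := perim_lt C; have [r1 r1P] := admissible_tent C.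
have En i : E i !=set0 by exists (r1 i), r1.
have Elb i : (i <= M)%N -> lbound (E i) (o i).
  by move=> iM _ [u [ou _ _ _ _] <-]; exact: ou.
have rle u i : admissible G M o s u -> (i <= M)%N -> r i <= u i.
  by move=> uP iM; apply: ge_inf; [exists (o i); exact: Elb|exists u].
have rge i y : (forall u, admissible G M o s u -> y <= u i) -> y <= r i.
  by move=> h; apply: lb_le_inf => // _ [u uP <-]; exact: h.
have ro i : (i <= M)%N -> o i <= r i.
  by move=> iM; apply: rge => u [+ _ _ _ _]; apply.
have r_0 : r 0%N = o 0%N.
  apply/eqP; rewrite eq_le ro // andbT.
  by have := rle r1 0%N r1P isT; case: r1P => _ -> .
have r_M : r M = o M.
  apply/eqP; rewrite eq_le ro // andbT.
  by have := rle r1 M r1P (leqnn M); case: r1P => _ _ ->.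
have r_s i : (i < M)%N -> r i <= r i.+1 + s i /\ r i.+1 <= r i + s i.
  move=> iM; split; rewrite -lerBlDr; apply: rge => u uP.
    have := rle u i uP (ltnW iM); case: uP => _ _ _ /(_ i iM) [h _] _; lra.
  have := rle u i.+1 uP iM; case: uP => _ _ _ /(_ i iM) [_ h] _; lra.
have rub i : (i <= M)%N -> r i <= x i /\ r i <= L - x i.
  move=> iM; have := rle r1 i r1P iM; have := admissible_le C r1P iM; lra.
have r_ge0 i : (i <= M)%N -> 0 <= r i by move=> iM; exact: le_trans (obs_ge0 C iM) (ro i iM).
have qle i u : (i <= M)%N -> admissible G M o s u -> vers G (r i) <= vers G (u i).
  move=> iM uP; have := rle u i uP iM; have := r_ge0 i iM; have := rub i iM.
  by have := admissible_le C uP iM => *; apply: vers_le; lra.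
(* Were the infimum reflex at a vertex, an admissible [u] close to it there would be reflex too: its
   neighbours are no lower than those of [r], so [stewart_le] and continuity apply. *)
have r_st i : (i.+1 < M)%N -> 0 <= stewart G (s i) (s i.+1) (r i.+1) (r i) (r i.+2).
  move=> iM; rewrite leNgt; apply/negP => neg.
  have e0 : 0 < - stewart G (s i) (s i.+1) (r i.+1) (r i) (r i.+2) by lra.
  have [dl dl0 near] := stewart_near G (s i) (s i.+1) (r i.+1) (r i) (r i.+2) e0.
  have [_ [u uP <-] ur] : exists2 e, E i.+1 e & e < r i.+1 + dl.
    by apply: inf_adherent => //; split=> //; exists (o i.+1); apply: Elb; lia.
  have := rle u i.+1 uP (ltnW iM) => ru.
  have /near : `|r i.+1 - u i.+1| < dl by rewrite ler0_norm; lra.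
  have : 0 <= stewart G (s i) (s i.+1) (u i.+1) (r i) (r i.+2).
    apply: (@le_trans _ _ (stewart G (s i) (s i.+1) (u i.+1) (u i) (u i.+2))).
      by case: uP => _ _ _ _; apply.
  apply: stewart_le; [exact/ltW/(sine_side C (ltnW iM))|exact/ltW/(sine_side C iM)|apply: qle => //; lia|exact: qle].
  by rewrite ltr_norml; lra.
have rP : admissible G M o s r by [].
exists r => // i iM ol; apply/eqP; rewrite eq_le r_st // andbT leNgt; apply/negP => st.
have [t tlt tP] := admissible_lower C rP iM ol st.
by have := rle _ i.+1 tP (ltnW iM); rewrite /= eqxx leNgt tlt.
Qed.

(** * Triangles and quadrilaterals in polar coordinates *)

Section Planar.
Variables (R : realType) (G : plane_geometry R).
Notation d := (@pdist R G).
Notation q := (vers G).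
Notation S := (sine G).
Notation H := (hlen G).
Notation k := (curv G).
Implicit Types r a : R.

(** The law of cosines in haversine form: [vers] of the distance between points of radii [r] and
    [r'] seen from the apex under the angle [a]. *)
Definition chord r r' a : R := q (r - r') + S r * S r' * (1 - cos a).

Lemma chordE r r' a :
  chord r r' a = q r + q r' - k * q r * q r' - S r * S r' * cos a.
Proof. by rewrite /chord versB; ring. Qed.

Lemma chordC r r' a : chord r r' a = chord r' r a.
Proof. by rewrite !chordE; ring. Qed.

Lemma chordN r r' a : chord r r' (- a) = chord r r' a.
Proof. by rewrite !chordE cosN. Qed.

Lemma chord0 r r' : chord r r' 0 = q (r - r').
Proof. by rewrite /chord cos0; ring. Qed.

Lemma chordpi r r' : chord r r' pi = q (r + r').
Proof. by rewrite chordE cospi versD; ring. Qed.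

(* [sine] of the distance times the cosine of the angle, at the point of radius
   [r], between the apex and the point of radius [r'] at polar angle [a]; the
   same product with the sine of that angle is [S r' * sin a]. *)
Definition inward r r' a : R :=
  S r * (1 - k * q r') - (1 - k * q r) * S r' * cos a.

(** The law of cosines at the point of radius [r], solved for the angle there; the factor [S r] is
    kept to avoid a division. *)
Lemma inward_chord r r' a :
  S r * inward r r' a =
  q r + chord r r' a - k * q r * chord r r' a - q r'.
Proof.
rewrite chordE /inward mulrBr mulrA -expr2 sine_sqr; ring.
Qed.

(** By the law of sines, the two squared terms are [S x] times the cosine and the sine of one
    angle. *)
Lemma inward_sqr r r' a x : q x = chord r r' a ->
  inward r r' a ^+ 2 + (S r' * sin a) ^+ 2 = S x ^+ 2.
Proof.
move=> e; rewrite sine_sqr e chordE exprMn sin2cos2.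
have -> : inward r r' a ^+ 2 = S r ^+ 2 * (1 - k * q r') ^+ 2
   - 2 * S r * S r' * (1 - k * q r) * (1 - k * q r') * cos a
   + (1 - k * q r) ^+ 2 * S r' ^+ 2 * cos a ^+ 2 by rewrite /inward; ring.
set X := q r + _ - _ - _.
have -> : X * (2 - k * X) =
  (q r + q r' - k * q r * q r') * (2 - k * (q r + q r' - k * q r * q r'))
  - 2 * (1 - k * (q r + q r' - k * q r * q r')) * S r * S r' * cos a
  - k * S r ^+ 2 * S r' ^+ 2 * cos a ^+ 2 by rewrite /X; ring.
rewrite !sine_sqr; ring.
Qed.

(** With alpha and beta the angles of the two triangles at the middle vertex, the right side is
    [S r * S s * S t] times cos alpha + cos beta. For positive sines it is nonnegative exactly when
    alpha + beta is at most pi. *)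
Lemma stewart_inward r r1 r2 a b s t :
  q s = chord r r1 a -> q t = chord r r2 b ->
  stewart G s t r r1 r2 = S r * (inward r r1 a * S t + inward r r2 b * S s).
Proof.
move=> es et; rewrite mulrDr !mulrA !inward_chord -es -et /stewart sineD; ring.
Qed.

(** The law of cosines in the triangle with sides [s] and [t]: the bracket is [S s * S t] times the
    cosine of the total angle at the middle vertex. *)
Lemma chord_add r r1 r2 a b s t :
  q s = chord r r1 a -> q t = chord r r2 b ->
  chord r1 r2 (a + b) = q s + q t - k * q s * q t
    - (inward r r1 a * inward r r2 b - S r1 * sin a * (S r2 * sin b)).
Proof.
move=> -> ->.
have -> : inward r r1 a * inward r r2 b =
  S r ^+ 2 * (1 - k * q r1) * (1 - k * q r2)
  - S r * (1 - k * q r) * ((1 - k * q r1) * S r2 * cos b + (1 - k * q r2) * S r1 * cos a)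
  + (1 - k * q r) ^+ 2 * S r1 * S r2 * cos a * cos b by rewrite /inward; ring.
have e : k * chord r r1 a * chord r r2 b =
  k * (q r + q r1 - k * q r * q r1) * (q r + q r2 - k * q r * q r2)
  - k * S r * ((q r + q r1 - k * q r * q r1) * S r2 * cos b
               + (q r + q r2 - k * q r * q r2) * S r1 * cos a)
  + k * S r ^+ 2 * S r1 * S r2 * cos a * cos b by rewrite !chordE; ring.
rewrite e !chordE cosD !sine_sqr; ring.
Qed.

(** Read [(u, v)] and [(u', v')] as vectors of lengths [s] and [t] at angles alpha and beta in
    [0, pi]. The last hypothesis says alpha + beta <= pi, the conclusion sin (alpha + beta) >= 0. *)
Lemma cos_sum_ge0 (u v u' v' s t : R) : 0 <= v -> 0 <= v' -> 0 <= s -> 0 <= t ->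
  u ^+ 2 + v ^+ 2 = s ^+ 2 -> u' ^+ 2 + v' ^+ 2 = t ^+ 2 ->
  0 <= u * t + u' * s -> 0 <= u * v' + u' * v.
Proof.
have aux (p w p' w' y z : R) : 0 <= w -> 0 <= w' -> 0 <= y -> 0 <= z ->
  p ^+ 2 + w ^+ 2 = y ^+ 2 -> p' ^+ 2 + w' ^+ 2 = z ^+ 2 ->
  0 <= p * z + p' * y -> p < 0 -> 0 <= p * w' + p' * w.
  move=> w0 w'0 y0 z0 e e' h pn.
  have [p'0|p'0] := lerP p' 0.
    have z00 : z = 0 by apply/eqP; rewrite eq_le z0 andbT leNgt; apply/negP => zp; nra.
    move: e'; rewrite z00 expr0n /= => /eqP.
    rewrite paddr_eq0 ?sqr_ge0 // !sqrf_eq0 => /andP[/eqP-> /eqP->].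
    by rewrite mulr0 mul0r addr0.
  suff : `|p * w'| <= `|p' * w|.
    have -> : `|p * w'| = - (p * w') by rewrite normrM (ltr0_norm pn) (ger0_norm w'0) mulNr.
    by rewrite (ger0_norm (mulr_ge0 (ltW p'0) w0)); lra.
  rewrite -ler_sqr ?nnegrE // !real_normK ?num_real // !exprMn.
  have : (- p * z) ^+ 2 <= (p' * y) ^+ 2 by rewrite ler_sqr ?nnegrE; nra.
  rewrite !exprMn -e -e' sqrrN; lra.
move=> v0 v'0 s0 t0 e e' h.
have [u0|u0] := ltP u 0; first exact: (aux u v u' v' s t).
have [u'0|u'0] := ltP u' 0; last by rewrite addr_ge0 // mulr_ge0.
by rewrite addrC; apply: (aux u' v' u v t s) => //; rewrite addrC.
Qed.

(** For vectors at angles alpha and beta in [0, pi], the last hypothesis is sin (beta - alpha) >= 0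
    up to a factor, so alpha <= beta and the cosines are in the opposite order. The nonvanishing
    hypothesis excludes alpha = pi, beta = 0. *)
Lemma cos_le (p y p' y' s t : R) : 0 <= y -> 0 <= y' -> 0 <= s -> 0 <= t ->
  p ^+ 2 + y ^+ 2 = s ^+ 2 -> p' ^+ 2 + y' ^+ 2 = t ^+ 2 ->
  (y != 0) || (y' != 0) -> 0 <= y' * p - p' * y -> p' * s <= p * t.
Proof.
move=> y0 y'0 s0 t0 e e' nz h.
have [p0|p0] := leP 0 p; have [p'0|p'0] := leP 0 p'.
- rewrite -ler_sqr ?nnegrE ?mulr_ge0 // !exprMn -e -e'.
  have : (p' * y) ^+ 2 <= (y' * p) ^+ 2 by rewrite ler_sqr ?nnegrE ?mulr_ge0 //; lra.
  by rewrite !exprMn; lra.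
- by apply: (@le_trans _ _ 0); nra.
- have h1 : y' * p <= 0 by nra.
  have h2 : 0 <= p' * y by rewrite mulr_ge0.
  have y'00 : y' = 0.
    by apply/eqP; rewrite eq_le y'0 andbT leNgt; apply/negP => y'p; nra.
  move: nz h; rewrite y'00 eqxx orbF => ny h.
  have yp : 0 < y by rewrite lt0r ny.
  have p'00 : p' = 0.
    by apply/eqP; rewrite eq_le p'0 andbT leNgt; apply/negP => p'p; nra.
  move: e'; rewrite p'00 y'00 expr0n addr0 => /esym/eqP; rewrite sqrf_eq0 => /eqP->.
  by rewrite mulr0 mul0r.
- suff : - p * t <= - p' * s by lra.
  rewrite -ler_sqr ?nnegrE; try nra; rewrite !exprMn -e -e' !sqrrN.
  have : (- p * y') ^+ 2 <= (- p' * y) ^+ 2 by rewrite ler_sqr ?nnegrE; nra.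
  by rewrite !exprMn !sqrrN; lra.
Qed.

Lemma sine_lt0 x : 0 < - x -> - x < H -> S x < 0.
Proof. by move=> x0 xH; have := sine_gt0 x0 xH; rewrite sineN; lra. Qed.

Lemma vers_eq_norm x y : 0 <= x -> x < H -> `|y| < H -> q x = q y -> x = `|y|.
Proof.
move=> x0 xH yH e; apply: (@vers_inj _ G) => //; last by rewrite vers_norm.
by move: xH yH; clear -G; lra.
Qed.

Lemma sine_norm x : `|x| < H -> S `|x| = `|S x|.
Proof.
have [x0|x0] := ger0P x => xH; first by rewrite ger0_norm // sine_ge0.
by rewrite sineN ltr0_norm // sine_lt0 // oppr_gt0.
Qed.

Lemma dist_lt r r' : 0 < r -> r < H -> 0 < r' -> r' < H -> `|r - r'| < H.
Proof. by move=> *; rewrite ltr_norml; lra. Qed.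

Lemma inward0 r r' : inward r r' 0 = S (r - r').
Proof. by rewrite /inward cos0 sineB; ring. Qed.

Lemma sine_inward_ge0 r a : 0 <= r -> r < H -> 0 <= a -> a <= pi -> 0 <= S r * sin a.
Proof.
by move=> r0 rH a0 api; rewrite mulr_ge0 ?sine_ge0 ?sin_ge0_pi // a0 api.
Qed.

(** The conclusion is about [S s * S t] times the sine of the total angle at m: convexity in the
    form of a weight for [tensegrity]. *)
Lemma det_ge0 ri rm rk a b s t :
  0 <= S rm * sin b -> 0 <= S rk * sin b -> 0 <= S ri * sin a ->
  0 <= S s -> 0 <= S t ->
  q s = chord rm ri a -> q t = chord rm rk b ->
  0 <= inward rm ri a * S t + inward rm rk b * S s ->
  0 <= inward rm ri a * (S rk * sin b) + inward rm rk b * (S ri * sin a).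
Proof.
move=> h1 h2 h3 s0 t0 es et h; apply: cos_sum_ge0 h => //; exact: inward_sqr.
Qed.

(* The hypothesis on [inward] says that the angle of the broken line i, m, k at
   m, on the side of the apex, is at most pi; the conclusion compares the angles
   that the apex makes at k with i and with m. *)
Lemma inward_mono ri rm rk a b s t x :
  0 < ri -> ri < H -> 0 < rm -> rm < H -> 0 < rk -> rk < H ->
  0 <= a -> 0 <= b -> a + b < pi ->
  0 <= s -> s < H -> 0 < t -> t < H -> 0 <= x -> x < H ->
  q s = chord rm ri a -> q t = chord rm rk b -> q x = chord rk ri (a + b) ->
  0 <= inward rm ri a * S t + inward rm rk b * S s ->
  inward rk rm b * S x <= inward rk ri (a + b) * S t.
Proof.
move=> i0 iH m0 mH k0 kH a0 b0 abpi s0 sH t0 tH x0 xH es et ex h.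
have Ss := sine_ge0 s0 sH; have St := sine_gt0 t0 tH; have Sx := sine_ge0 x0 xH.
have Si := sine_gt0 i0 iH; have Sm := sine_gt0 m0 mH; have Sk := sine_gt0 k0 kH.
have et' : q t = chord rk rm b by rewrite chordC.
have ab0 : 0 <= a + b by rewrite addr_ge0.
have bpi : b < pi by rewrite (le_lt_trans _ abpi) // lerDr.
have api : a < pi by rewrite (le_lt_trans _ abpi) // lerDl.
have ya : 0 <= S ri * sin (a + b) by apply: sine_inward_ge0 => //; exact: ltW.
have yb : 0 <= S rm * sin b by apply: sine_inward_ge0 => //; exact: ltW.
have [nz|] := boolP ((S ri * sin (a + b) != 0) || (S rm * sin b != 0)).
  apply: (cos_le ya yb Sx (ltW St) (inward_sqr ex) (inward_sqr et') nz).
  have y1 : 0 <= S rk * sin b by apply: sine_inward_ge0 => //; exact: ltW.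
  have y2 : 0 <= S ri * sin a by apply: sine_inward_ge0 => //; exact: ltW.
  have := det_ge0 yb y1 y2 Ss (ltW St) es et h.
  have -> : inward rm ri a * (S rk * sin b) + inward rm rk b * (S ri * sin a) =
    S rm * sin b * inward rk ri (a + b) - inward rk rm b * (S ri * sin (a + b)).
    apply/esym/subr0_eq; transitivity ((1 - k * q rk) * S rm * S ri * sin a *
      (cos b ^+ 2 + sin b ^+ 2 - 1)); first by rewrite /inward sinD cosD; ring.
    by rewrite cos2Dsin2 subrr mulr0.
  by rewrite subr_ge0.
(* Both sines vanish, so [a = b = 0]: the three points lie on one ray and only their order
   matters. *)
rewrite negb_or !negbK => /andP[ea _].
have [abp|abn] := ltP 0 (a + b).
  by move: ea; rewrite gt_eqF // mulr_gt0 // sin_gt0_pi // abp.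
have [a00 b00] : a = 0 /\ b = 0 by move: a0 b0 abn; clear -G; lra.
move: h es et ex; rewrite a00 b00 addr0 !chord0 !inward0 => h es et ex.
have hkm := dist_lt k0 kH m0 mH; have hki := dist_lt k0 kH i0 iH.
have hmi := dist_lt m0 mH i0 iH; have hmk := dist_lt m0 mH k0 kH.
have St2 : S t = `|S (rk - rm)|.
  by rewrite -sine_norm // distrC; congr S; apply: vers_eq_norm => //; exact: ltW.
have Sx2 : S x = `|S (rk - ri)| by rewrite -sine_norm //; congr S; exact: vers_eq_norm.
have Ss2 : S s = `|S (rm - ri)| by rewrite -sine_norm //; congr S; exact: vers_eq_norm.
have sgn y : `|y| < H -> 0 < S y -> 0 < y.
  rewrite ltr_norml => /andP[yl yr]; rewrite !ltNge; apply: contra.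
  rewrite le_eqVlt => /orP[/eqP->|y0]; rewrite ?sine0 // ltW // sine_lt0 //.
    by rewrite oppr_gt0.
  by rewrite ltrNl.
have [z2|z2] := leP 0 (S (rk - ri)).
  by rewrite Sx2 St2 (ger0_norm z2) [leRHS]mulrC ler_wpM2r // ler_norm.
have [z1|z1] := leP (S (rk - rm)) 0.
  by rewrite Sx2 St2 (ltr0_norm z2) (ler0_norm z1) !mulrN mulrC.
(* The remaining order has m nearest to the apex; both angles at m are then pi, against [h]. *)
exfalso; have c1 := sgn _ hkm z1.
have c2 : 0 < ri - rk.
  by apply: sgn; [rewrite distrC|rewrite -opprB sineN oppr_gt0].
have n1 : S (rm - ri) < 0.
  apply: sine_lt0; first by move: c1 c2; clear -G; lra.
  by rewrite opprB (le_lt_trans (ler_norm _)) // distrC.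
have n2 : S (rm - rk) < 0 by rewrite -opprB sineN oppr_lt0.
by move: h St n1 n2 Ss; clear -G; nra.
Qed.

(** The angles at the middle vertex add up to pi: their cosines are opposite, their sines agree, and
    [chord_add] becomes the addition formula for [vers]. *)
Lemma chord_straight r r1 r2 a b s t :
  0 <= S r1 * sin a -> 0 <= S r2 * sin b -> 0 < S s -> 0 < S t ->
  q s = chord r r1 a -> q t = chord r r2 b ->
  inward r r1 a * S t + inward r r2 b * S s = 0 ->
  chord r1 r2 (a + b) = q (s + t).
Proof.
move=> y1 y2 s0 t0 es et h; rewrite (chord_add es et) versD.
have := inward_sqr es; have := inward_sqr et; move: y1 y2 h.
move: (inward r r1 a) (inward r r2 b) (S r1 * sin a) (S r2 * sin b) => u u' v v'.
move: (S s) (S t) s0 t0 => s' t' s0 t0 v0 v'0 h e' e.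
have e1 : v * t' = v' * s'.
  apply/eqP; rewrite -(@eqrXn2 _ 2) ?mulr_ge0 // ?ltW //; apply/eqP.
  have : (u * t') ^+ 2 = (u' * s') ^+ 2 by rewrite (_ : u * t' = - (u' * s')) ?sqrrN //; lra.
  rewrite !exprMn -e -e'; lra.
have : s' * t' * (u * u' - v * v' + s' * t') = 0.
  have -> : s' * t' * (u * u' - v * v' + s' * t') =
    u * t' * (u' * s') - v * t' * (v' * s') + s' ^+ 2 * t' ^+ 2 by ring.
  have -> : u' * s' = - (u * t') by lra.
  by rewrite -e1 -e; ring.
move=> /eqP; rewrite !mulf_eq0 (gt_eqF s0) (gt_eqF t0) /= => /eqP; lra.
Qed.

(** From the end k of a straight broken line, i and m are seen in the same direction. Up to the
    factor [S rk], the difference of the two sides is the [stewart] expression. *)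
Lemma inward_straight ri rm rk a b s t :
  0 < S rk -> q t = chord rk rm b -> q (s + t) = chord rk ri (a + b) ->
  stewart G s t rm ri rk = 0 ->
  inward rk ri (a + b) * S t = inward rk rm b * S (s + t).
Proof.
move=> k0 et ex st; apply: (mulfI (lt0r_neq0 k0)); rewrite !mulrA !inward_chord -et -ex.
apply: subr0_eq; rewrite -[RHS]st.
transitivity (stewart G s t rm ri rk + S s * (1 - k * q rk) *
  (S t ^+ 2 - q t * (2 - k * q t))); first by rewrite /stewart sineD versD; ring.
by rewrite sine_sqr; ring.
Qed.

Lemma chord_ge0 r r' a : 0 <= r -> r < H -> 0 <= r' -> r' < H -> 0 <= chord r r' a.
Proof.
move=> r0 rH r'0 r'H; rewrite addr_ge0 //.
  rewrite -vers_norm vers_ge0 //; have [?|?] := ger0P (r - r'); lra.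
rewrite !mulr_ge0 ?sine_ge0 // subr_ge0; exact: cos_le1.
Qed.

(** The weights given to [tensegrity] are the linear dependency of the four vertices of the polar
    quadrilateral apex, i, k, j: each weight is the determinant of the other three. Their signs come
    from [al + be < pi] and from convexity at k. *)
Lemma quad_le (o a c b : G) ri rk rj al be s t :
  0 < ri -> ri < H -> 0 < rk -> rk < H -> 0 < rj -> rj < H ->
  0 <= al -> 0 <= be -> al + be < pi ->
  0 <= s -> s < H -> 0 <= t -> t < H ->
  q s = chord rk ri al -> q t = chord rk rj be ->
  0 <= inward rk ri al * S t + inward rk rj be * S s ->
  q (d o a) <= q ri -> q (d o b) <= q rj -> q rk <= q (d o c) ->
  q (d a c) <= chord rk ri al -> q (d c b) <= chord rk rj be ->
  q (d a b) <= chord ri rj (al + be).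
Proof.
move=> i0 iH k0 kH j0 jH al0 be0 abpi s0 sH t0 tH es et h oa ob oc ac cb.
have Ss := sine_ge0 s0 sH; have St := sine_ge0 t0 tH.
have Si := sine_gt0 i0 iH; have Sk := sine_gt0 k0 kH; have Sj := sine_gt0 j0 jH.
have qk : 0 <= q rk by apply: vers_ge0; move: k0 kH; clear -G; lra.
have qab : 0 <= chord ri rj (al + be) by apply: chord_ge0 => //; exact: ltW.
(* If both angles vanish, the vertices lie on one ray and every determinant is zero. The dependency
   that puts [a], or else [b], between [o] and [c] is used instead, with fourth weight zero. *)
have [ab0|ab0] := ltP 0 (al + be); last first.
  have [al00 be00] : al = 0 /\ be = 0 by move: al0 be0 ab0; clear -G; lra.
  move: h es et oa ob oc ac cb qab; rewrite al00 be00 addr0 !chord0.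
  rewrite !inward0 => h es et oa ob oc ac cb qab.
  have Srk := ltW Sk; have Sri := ltW Si; have Srj := ltW Sj.
  have ss x : S x ^+ 2 - q x * (2 - k * q x) = 0 by rewrite sine_sqr subrr.
  have [c1|c1] := leP ri rk.
    have D0 : 0 <= S (rk - ri) by apply: sine_ge0; move: c1 kH i0; clear -G; lra.
    apply: (@tensegrity _ G o a c b (q ri) (q rk) (q rj) (q (rk - ri)) (q (rk - rj))
      (q (ri - rj)) _ (S rk) (S ri) 0 (S ri * q rk - S rk * q ri)
      D0 Srk Sri (lexx _) _ (ltr_wpDl D0 Si) qk qab _ _ _ _ _ oa ob ac cb oc).
    - by rewrite addr0.
    - rewrite sineB; ring.
    - ring.
    - apply: subr0_eq; transitivity (S ri * (S rk ^+ 2 - q rk * (2 - k * q rk))).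
        by rewrite sineB !versB; ring.
      by rewrite ss mulr0.
    - apply: subr0_eq; transitivity (- S rk * (S ri ^+ 2 - q ri * (2 - k * q ri))).
        by rewrite sineB !versB; ring.
      by rewrite ss mulr0.
    - by rewrite sineB !versB; ring.
  have [c2|c2] := leP rj rk.
    have D0 : 0 <= S (rk - rj) by apply: sine_ge0; move: c2 kH j0; clear -G; lra.
    apply: (@tensegrity _ G o a c b (q ri) (q rk) (q rj) (q (rk - ri)) (q (rk - rj))
      (q (ri - rj)) _ 0 (S rj) (S rk) (S rj * q rk - S rk * q rj)
      D0 (lexx _) Srj Srk _ (ltr_wpDl D0 Sj) qk qab _ _ _ _ _ oa ob ac cb oc).
    - by rewrite add0r.
    - rewrite sineB; ring.
    - ring.
    - apply: subr0_eq; transitivity (S rj * (S rk ^+ 2 - q rk * (2 - k * q rk))).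
        by rewrite sineB !versB; ring.
      by rewrite ss mulr0.
    - by rewrite sineB !versB; ring.
    - apply: subr0_eq; transitivity (- S rk * (S rj ^+ 2 - q rj * (2 - k * q rj))).
        by rewrite sineB !versB; ring.
      by rewrite ss mulr0.
  (* Otherwise k is nearer to the apex than both i and j, which makes the angle at k equal to 2
     pi. *)
  exfalso; move: h.
  have hki := dist_lt k0 kH i0 iH; have hkj := dist_lt k0 kH j0 jH.
  have -> : S s = `|S (rk - ri)| by rewrite -sine_norm //; congr S; exact: vers_eq_norm.
  have -> : S t = `|S (rk - rj)| by rewrite -sine_norm //; congr S; exact: vers_eq_norm.
  have n1 : S (rk - ri) < 0 by apply: sine_lt0; move: c1 iH k0; clear -G; lra.
  have n2 : S (rk - rj) < 0 by apply: sine_lt0; move: c2 jH k0; clear -G; lra.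
  by rewrite (ltr0_norm n1) (ltr0_norm n2); move: n1 n2; clear -G; nra.
have sab : 0 < sin (al + be) by apply: sin_gt0_pi; rewrite ab0.
have sa : 0 <= sin al by apply: sin_ge0_pi; move: al0 be0 abpi; clear -G; lra.
have sb : 0 <= sin be by apply: sin_ge0_pi; move: al0 be0 abpi; clear -G; lra.
have D0 : 0 <= inward rk ri al * (S rj * sin be) + inward rk rj be * (S ri * sin al).
  by apply: (@det_ge0 ri rk rj al be s t) => //; rewrite mulr_ge0 // ltW.
pose lc := S ri * S rj * sin (al + be).
have lc0 : 0 < lc by rewrite !mulr_gt0.
pose la := S rk * S rj * sin be; pose lb := S rk * S ri * sin al.
have la0 : 0 <= la by rewrite !mulr_ge0 // ltW.
have lb0 : 0 <= lb by rewrite !mulr_ge0 // ltW.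
have lab : 0 < la + lb.
  have [al0'|al0'] := ltP 0 al.
    by rewrite ltr_wpDl // !mulr_gt0 // sin_gt0_pi // al0'; move: abpi be0; clear -G; lra.
  rewrite ltr_wpDr // !mulr_gt0 // sin_gt0_pi //.
  by move: ab0 al0' abpi be0 al0; clear -G; lra.
have c2s2 x : cos x ^+ 2 + sin x ^+ 2 - 1 = 0 by rewrite cos2Dsin2 subrr.
have ss x : S x ^+ 2 - q x * (2 - k * q x) = 0 by rewrite sine_sqr subrr.
apply: (@tensegrity _ G o a c b (q ri) (q rk) (q rj) (chord rk ri al) (chord rk rj be)
  (chord ri rj (al + be)) _ la lc lb (lc * q rk - la * q ri - lb * q rj)
  D0 la0 (ltW lc0) lb0 lab (ltr_wpDl D0 lc0) qk qab) => //.
- by rewrite /la /lb /lc /inward sinD; ring.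
- apply: subr0_eq; rewrite /la /lb /lc !chordE /inward sinD.
  transitivity (S ri * S rj * (cos al * sin be + sin al * cos be) *
    (S rk ^+ 2 - q rk * (2 - k * q rk))); first by ring.
  by rewrite ss mulr0.
- apply: subr0_eq; rewrite /la /lb /lc !chordE /inward sinD cosD.
  transitivity (- (S rk * S rj * sin be) * ((S ri ^+ 2 - q ri * (2 - k * q ri))
    + S ri ^+ 2 * (cos al ^+ 2 + sin al ^+ 2 - 1))); first by ring.
  by rewrite ss c2s2 mulr0 addr0 mulr0.
- apply: subr0_eq; rewrite /la /lb /lc !chordE /inward sinD cosD.
  transitivity (- (S rk * S ri * sin al) * ((S rj ^+ 2 - q rj * (2 - k * q rj))
    + S rj ^+ 2 * (cos be ^+ 2 + sin be ^+ 2 - 1))); first by ring.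
  by rewrite ss c2s2 mulr0 addr0 mulr0.
Qed.
End Planar.

(** * Cones *)

Section Cone.
Variables (R : realType) (G : plane_geometry R).
Notation d := (@pdist R G).
Notation q := (vers G).
Notation H := (hlen G).
Implicit Types r a b : R.

Lemma pdist_ge0 (a b : G) : 0 <= d a b.
Proof.
by have := pdist_triangle b a a; rewrite pdistxx [d b a]pdistC -mulr2n pmulrn_lge0.
Qed.

Lemma pdist_eq (a b c e : G) : q (d a b) = q (d c e) -> d a b = d c e.
Proof. by move=> h; apply/eqP; rewrite eq_le -!vers_pdist h lexx. Qed.

Definition polard r r' a : R := d (polar G r 0) (polar G r' a).

Section PolarDistance.
Variables r r' : R.
Hypotheses (r0 : 0 <= r) (rH : r <= H) (r'0 : 0 <= r') (r'H : r' <= H).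

Lemma vers_polard a : q (polard r r' a) = chord G r r' a.
Proof. by rewrite vers_polar // sub0r cosN. Qed.

Lemma pdist_polar a b : d (polar G r a) (polar G r' b) = polard r r' (b - a).
Proof. by apply: pdist_eq; rewrite !vers_polar // sub0r opprB. Qed.

Lemma polard_le_add a : polard r r' a <= r + r'.
Proof.
have := pdist_triangle (polar G 0 0) (polar G r 0) (polar G r' a).
by rewrite [d _ (polar G 0 0)]pdistC !polar0.
Qed.

Lemma le_add_polard a : r <= r' + polard r r' a.
Proof.
have := pdist_triangle (polar G r' a) (polar G 0 0) (polar G r 0).
by rewrite [d (polar G r' a) (polar G r 0)]pdistC !polar0.
Qed.

Lemma le_add_polard' a : r' <= r + polard r r' a.
Proof.
have := pdist_triangle (polar G r 0) (polar G 0 0) (polar G r' a).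
by rewrite !polar0.
Qed.

Lemma polard_ge0 a : 0 <= polard r r' a.
Proof. exact: pdist_ge0. Qed.

(** In positive curvature the shorter way between opposite points may avoid the apex; the bound
    excludes this and makes [vers] injective on the lengths involved. *)
Lemma polard_pi : polard r r' pi + (r + r') < 2 * H -> polard r r' pi = r + r'.
Proof.
move=> h; apply: (@vers_inj _ G) => //; first exact: polard_ge0.
  exact: addr_ge0.
by rewrite vers_polard chordpi.
Qed.

End PolarDistance.

Lemma polardC r r' a : 0 <= r -> r <= H -> 0 <= r' -> r' <= H ->
  polard r r' a = polard r' r a.
Proof. by move=> *; apply: pdist_eq; rewrite !vers_polard // chordC. Qed.

Lemma polardN r r' a : 0 <= r -> r <= H -> 0 <= r' -> r' <= H ->
  polard r r' (- a) = polard r r' a.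
Proof. by move=> *; apply: pdist_eq; rewrite !vers_polard // chordN. Qed.

Lemma polard_triangle r1 r2 r3 a b : 0 <= r1 -> r1 <= H -> 0 <= r2 -> r2 <= H ->
  0 <= r3 -> r3 <= H -> polard r1 r3 (a + b) <= polard r1 r2 a + polard r2 r3 b.
Proof.
move=> *; have := pdist_triangle (polar G r2 a) (polar G r1 0) (polar G r3 (a + b)).
by rewrite !pdist_polar // !subr0 addrAC subrr add0r.
Qed.

Lemma le_cos a b : 0 <= a -> a <= b -> b <= pi -> cos b <= cos a :> R.
Proof.
rewrite le_eqVlt => a0; rewrite le_eqVlt => /orP[/eqP->//|ab] bpi.
rewrite ltW // ltr_cos //; rewrite in_itv /=; lra.
Qed.

Lemma polard_mono r r' a b : 0 <= r -> r < H -> 0 <= r' -> r' < H ->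
  0 <= a -> a <= b -> b <= pi -> polard r r' a <= polard r r' b.
Proof.
move=> r0 rH r'0 r'H a0 ab bpi; have rH' := ltW rH; have r'H' := ltW r'H.
rewrite -vers_pdist !vers_polard // /chord lerD2l ler_wpM2l ?mulr_ge0 ?sine_ge0 // lerD2l lerN2.
exact: le_cos.
Qed.

(* Intrinsic distance in a cone glued from sectors of the model plane: beyond
   angle pi, geodesics pass through the apex. *)
Definition coned r r' a : R := if a < pi then polard r r' a else r + r'.

Lemma coned_le_add r r' a : 0 <= r -> r <= H -> 0 <= r' -> r' <= H ->
  coned r r' a <= r + r'.
Proof. by move=> *; rewrite /coned; case: ifP => // _; exact: polard_le_add. Qed.

Lemma coned_ge0 r r' a : 0 <= r -> 0 <= r' -> 0 <= coned r r' a.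
Proof.
by move=> *; rewrite /coned; case: ifP => _; rewrite ?polard_ge0 ?addr_ge0.
Qed.

Lemma le_add_coned r r' a : 0 <= r -> r <= H -> 0 <= r' -> r' <= H ->
  r <= r' + coned r r' a.
Proof.
by move=> *; rewrite /coned; case: ifP => _; [exact: le_add_polard|lra].
Qed.

Lemma le_add_coned' r r' a : 0 <= r -> r <= H -> 0 <= r' -> r' <= H ->
  r' <= r + coned r r' a.
Proof.
by move=> *; rewrite /coned; case: ifP => _; [exact: le_add_polard'|lra].
Qed.

(** The interesting case has both sectors below pi but not their sum. Shrinking the second to
    [pi - a] does not increase its distance and puts the outer points opposite each other in the
    plane, at distance [r1 + r3] by the perimeter bound. *)
Lemma coned_triangle r1 r2 r3 a b : 0 <= r1 -> r1 < H -> 0 <= r2 -> r2 < H ->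
  0 <= r3 -> r3 < H -> 0 <= a -> 0 <= b ->
  coned r1 r2 a + coned r2 r3 b + (r1 + r3) < 2 * H ->
  coned r1 r3 (a + b) <= coned r1 r2 a + coned r2 r3 b.
Proof.
move=> p1 h1 p2 h2 p3 h3 a0 b0.
have [e1 e2 e3] : [/\ r1 <= H, r2 <= H & r3 <= H] by split; exact: ltW.
have l1 := le_add_coned b p2 e2 p3 e3; have l2 := le_add_coned' b p2 e2 p3 e3.
have l3 := le_add_coned a p1 e1 p2 e2; have l4 := le_add_coned' a p1 e1 p2 e2.
have [abpi|abpi] := ltP (a + b) pi.
  have api : a < pi by move: abpi b0; clear -G; lra.
  have bpi : b < pi by move: abpi a0; clear -G; lra.
  by rewrite /coned abpi api bpi => _; exact: polard_triangle.
have -> : coned r1 r3 (a + b) = r1 + r3 by rewrite /coned ltNge abpi.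
have [api|api] := ltP a pi; last first.
  have -> : coned r1 r2 a = r1 + r2 by rewrite /coned ltNge api.
  by move: l2; clear -G; lra.
have [bpi|bpi] := ltP b pi; last first.
  have -> : coned r2 r3 b = r2 + r3 by rewrite /coned ltNge bpi.
  by move: l3; clear -G; lra.
have -> : coned r1 r2 a = polard r1 r2 a by rewrite /coned api.
have -> : coned r2 r3 b = polard r2 r3 b by rewrite /coned bpi.
have t := polard_triangle a (pi - a) p1 e1 p2 e2 p3 e3.
have m : polard r2 r3 (pi - a) <= polard r2 r3 b.
  by apply: polard_mono => //; move: api abpi bpi; clear -G; lra.
rewrite addrC subrK in t => h; rewrite -polard_pi //.
  by move: t m; clear -G; lra.
by move: t m h; clear -G; lra.
Qed.

Lemma coned_triangle' r1 r2 r3 a b : 0 <= r1 -> r1 < H -> 0 <= r2 -> r2 < H ->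
  0 <= r3 -> r3 < H -> 0 <= a -> 0 <= b ->
  coned r1 r2 a <= coned r1 r3 (a + b) + coned r2 r3 b.
Proof.
move=> p1 h1 p2 h2 p3 h3 a0 b0.
have [e1 e2 e3] : [/\ r1 <= H, r2 <= H & r3 <= H] by split; exact: ltW.
have l1 := le_add_coned b p2 e2 p3 e3.
have l2 := coned_le_add a p1 e1 p2 e2.
have [abpi|abpi] := ltP (a + b) pi; last first.
  have -> : coned r1 r3 (a + b) = r1 + r3 by rewrite /coned ltNge abpi.
  by move: l1 l2; clear -G; lra.
have api : a < pi by move: abpi b0; clear -G; lra.
have bpi : b < pi by move: abpi a0; clear -G; lra.
rewrite /coned abpi api bpi.
have := polard_triangle (a + b) (- b) p1 e1 p3 e3 p2 e2.
by rewrite addrK polardN // [polard r3 r2 b]polardC.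
Qed.

Lemma coned_triangle'' r1 r2 r3 a b : 0 <= r1 -> r1 < H -> 0 <= r2 -> r2 < H ->
  0 <= r3 -> r3 < H -> 0 <= a -> 0 <= b ->
  coned r2 r3 b <= coned r1 r2 a + coned r1 r3 (a + b).
Proof.
move=> p1 h1 p2 h2 p3 h3 a0 b0.
have [e1 e2 e3] : [/\ r1 <= H, r2 <= H & r3 <= H] by split; exact: ltW.
have l1 := le_add_coned' a p1 e1 p2 e2.
have l2 := coned_le_add b p2 e2 p3 e3.
have [abpi|abpi] := ltP (a + b) pi; last first.
  have -> : coned r1 r3 (a + b) = r1 + r3 by rewrite /coned ltNge abpi.
  by move: l1 l2; clear -G; lra.
have api : a < pi by move: abpi b0; clear -G; lra.
have bpi : b < pi by move: abpi a0; clear -G; lra.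
rewrite /coned abpi api bpi.
have := polard_triangle (- a) (a + b) p2 e2 p1 e1 p3 e3.
by rewrite addKr polardN // [polard r2 r1 a]polardC.
Qed.

End Cone.

(** The angles [phi] accumulate and are not reduced modulo 2 pi. [cone_apex] ensures that a sector
    narrower than pi contains positive radii only. *)
Record cone_chain (R : realType) (G : plane_geometry R) (M : nat)
    (r phi s x : nat -> R) (L : R) : Prop := ConeChain {
  cone_perim : L < 2 * hlen G;
  cone_ge0 : forall i, (i <= M)%N -> 0 <= r i;
  cone_le : forall i, (i <= M)%N -> r i <= x i;
  cone_leC : forall i, (i <= M)%N -> r i <= L - x i;
  cone_pos : forall i, (i < M)%N -> x i.+1 = x i + s i;
  cone_side_gt0 : forall i, (i < M)%N -> 0 < s i;
  cone_step : forall i, (i < M)%N -> phi i <= phi i.+1;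
  cone_step_pi : forall i, (i < M)%N -> phi i.+1 - phi i <= pi;
  cone_chord : forall i, (i < M)%N ->
    vers G (s i) = chord G (r i) (r i.+1) (phi i.+1 - phi i);
  cone_apex : forall i, (i < M)%N -> r i = 0 \/ r i.+1 = 0 ->
    phi i.+1 - phi i = pi
}.

Section ConeChain.
Variables (R : realType) (G : plane_geometry R).
Notation d := (@pdist R G).
Notation q := (vers G).
Notation S := (sine G).
Notation H := (hlen G).

Lemma vers_le_pdist y (a b : G) : 0 <= y -> y <= H ->
  (q y <= q (d a b)) = (y <= d a b).
Proof. by move=> y0 yH; rewrite -[in LHS](polar0 0 0 y0 yH) vers_pdist polar0. Qed.

Lemma vers_pdist_le y (a b : G) : 0 <= y -> y <= H ->
  (q (d a b) <= q y) = (d a b <= y).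
Proof. by move=> y0 yH; rewrite -[in LHS](polar0 0 0 y0 yH) vers_pdist polar0. Qed.

Variables (M : nat) (r phi s x : nat -> R) (L : R).
Hypothesis C : cone_chain G M r phi s x L.
Notation cd i j := (coned G (r i) (r j) (phi j - phi i)).

Lemma cone_lt i : (i <= M)%N -> r i < H.
Proof.
move=> iM; have := cone_perim C; have := cone_le C iM; have := cone_leC C iM.
by clear -C; lra.
Qed.

Lemma cone_mono i j : (i <= j)%N -> (j <= M)%N -> phi i <= phi j.
Proof.
elim: j => [|j IH]; first by rewrite leqn0 => /eqP->.
rewrite leq_eqVlt => /orP[/eqP->//|ij jM].
by apply: le_trans (IH ij (ltnW jM)) _; apply: cone_step C _ _.
Qed.

Lemma cone_pos_mono i j : (i <= j)%N -> (j <= M)%N -> x i <= x j.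
Proof.
elim: j => [|j IH]; first by rewrite leqn0 => /eqP->.
rewrite leq_eqVlt => /orP[/eqP->//|ij jM].
apply: le_trans (IH ij (ltnW jM)) _; rewrite (cone_pos C jM).
by rewrite lerDl ltW // (cone_side_gt0 C).
Qed.

Lemma conedxx i : cd i i = 0.
Proof. by rewrite /coned subrr pi_gt0 /polard pdistxx. Qed.

Lemma vers_coned i j : (i <= M)%N -> (j <= M)%N -> phi j - phi i < pi ->
  q (cd i j) = chord G (r i) (r j) (phi j - phi i).
Proof.
move=> iM jM h; rewrite /coned h vers_polard ?(cone_ge0 C) //; exact/ltW/cone_lt.
Qed.

Lemma coned_side i : (i < M)%N -> cd i i.+1 = s i.
Proof.
move=> iM; have iM' := ltnW iM.
have r0 := cone_ge0 C iM'; have r1 := cone_ge0 C iM.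
have r0H := ltW (cone_lt iM'); have r1H := ltW (cone_lt iM).
have hs : s i + (r i + r i.+1) < 2 * H.
  have := cone_perim C; have := cone_le C iM'; have := cone_leC C iM.
  by have := cone_pos C iM; clear -C; lra.
have s0 := ltW (cone_side_gt0 C iM).
apply: (@vers_inj _ G) => //; first exact: coned_ge0.
  apply: le_lt_trans hs; rewrite addrC lerD2l; exact: coned_le_add.
have [h|h] := ltP (phi i.+1 - phi i) pi; first by rewrite vers_coned // (cone_chord C iM).
have e : phi i.+1 - phi i = pi.
  by apply/eqP; rewrite eq_le h (cone_step_pi C iM).
by rewrite (cone_chord C iM) e chordpi /coned ltxx.
Qed.

Lemma coned_le_len i j : (i <= j)%N -> (j <= M)%N -> cd i j <= x j - x i.
Proof.
elim: j => [|j IH]; first by rewrite leqn0 => /eqP-> _; rewrite conedxx // subrr.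
rewrite leq_eqVlt => /orP[/eqP<- iM|ij jM]; first by rewrite conedxx // subrr.
have ij' : (i <= j)%N by []; have jM' := ltnW jM; have iM := leq_trans ij' jM'.
have {}IH := IH ij jM'; have e := coned_side jM; have xj := cone_pos C jM.
have -> : phi j.+1 - phi i = (phi j - phi i) + (phi j.+1 - phi j) by ring.
have := @coned_triangle _ G (r i) (r j) (r j.+1) (phi j - phi i) (phi j.+1 - phi j).
rewrite e => /(_ (cone_ge0 C iM) (cone_lt iM) (cone_ge0 C jM') (cone_lt jM')
  (cone_ge0 C jM) (cone_lt jM)).
rewrite !subr_ge0 => /(_ (cone_mono ij' jM') (cone_step C jM)) t.
apply: le_trans (t _) _.
  have := cone_perim C; have := cone_le C iM; have := cone_leC C jM.
  by move: IH xj; clear -C; lra.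
by move: IH xj; clear -C; lra.
Qed.

(** The distance is at most the length along the chain and at most the way through the apex, and
    these add up to at most [L]. *)
Lemma coned_lt i j : (i <= j)%N -> (j <= M)%N -> cd i j < H.
Proof.
move=> ij jM; have iM := leq_trans ij jM.
have := coned_le_len ij jM; have := cone_perim C.
have := coned_le_add (phi j - phi i) (cone_ge0 C iM) (ltW (cone_lt iM))
  (cone_ge0 C jM) (ltW (cone_lt jM)).
by have := cone_le C iM; have := cone_leC C jM; clear -C; lra.
Qed.

Lemma coned_triangles i k j : (i <= k)%N -> (k <= j)%N -> (j <= M)%N ->
  [/\ cd i j <= cd i k + cd k j, cd i k <= cd i j + cd k j &
      cd k j <= cd i k + cd i j].
Proof.
move=> ik kj jM; have kM := leq_trans kj jM; have iM := leq_trans ik kM.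
have a0 : 0 <= phi k - phi i by rewrite subr_ge0 cone_mono.
have b0 : 0 <= phi j - phi k by rewrite subr_ge0 cone_mono.
have -> : phi j - phi i = (phi k - phi i) + (phi j - phi k) by ring.
have [[i0 k0] j0] := (cone_ge0 C iM, cone_ge0 C kM, cone_ge0 C jM).
split.
- apply: coned_triangle => //; try exact: cone_lt.
  have := coned_le_len ik kM; have := coned_le_len kj jM; have := cone_perim C.
  by have := cone_le C iM; have := cone_leC C jM; clear -C; lra.
- by apply: coned_triangle' => //; exact: cone_lt.
- by apply: coned_triangle'' => //; exact: cone_lt.
Qed.

Lemma cone_apex_gt0 i j k : (i < j)%N -> (j <= M)%N -> phi j - phi i < pi ->
  (i <= k)%N -> (k <= j)%N -> 0 < r k.
Proof.
move=> ij jM h ik kj; have kM := leq_trans kj jM.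
rewrite lt0r (cone_ge0 C kM) andbT; apply/eqP => r0.
suff [m mi [mj e]] : exists2 m, (i <= m)%N & (m < j)%N /\ phi m.+1 - phi m = pi.
  have := cone_mono mi (ltnW (leq_trans mj jM)); have := cone_mono mj jM.
  by move: h e; clear -C; lra.
have [e|n] := eqVneq k j; last first.
  exists k => //; have kj' : (k < j)%N by rewrite ltn_neqAle n.
  by split => //; apply: (cone_apex C); [exact: leq_trans jM|left].
have e1 : j.-1.+1 = j by rewrite prednK // (leq_trans _ ij).
exists j.-1; first by rewrite -ltnS e1.
split; rewrite ?e1 //; rewrite -[X in phi X]e1; apply: (cone_apex C); rewrite e1 //.
by right; rewrite -e.
Qed.

Lemma cone_pi_le i j : (i <= j)%N -> (j <= M)%N -> pi <= phi j - phi i ->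
  r i + r j <= x j - x i.
Proof. by move=> ij jM h; have := coned_le_len ij jM; rewrite /coned ltNge h. Qed.

End ConeChain.

(** In terms of cosines: [u / a <= v / c] and [0 <= u / a + w / b] give [0 <= v / c + w / b].
    Denominators are cleared because [b] and [c] may vanish. *)
Lemma transfer_ge0 (R : realDomainType) (u v w a b c : R) :
  0 < a -> 0 <= b -> 0 <= c -> u * c <= v * a -> 0 <= u * b + w * a ->
  0 <= v * b + w * c.
Proof.
move=> a0 b0 c0 h1 h2; rewrite -(pmulr_lge0 _ a0).
have : u * c * b <= v * a * b by rewrite ler_wpM2r.
by have := mulr_ge0 h2 c0; lra.
Qed.

(** * Convex chains in a cone: distant vertices, straight runs, lower bounds for distances *)

Section ConvexChain.
Variables (R : realType) (G : plane_geometry R).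
Notation d := (@pdist R G).
Notation q := (vers G).
Notation S := (sine G).
Notation H := (hlen G).
Variables (M : nat) (r phi s x : nat -> R) (L : R).
Hypothesis C : cone_chain G M r phi s x L.
Notation cd i j := (coned G (r i) (r j) (phi j - phi i)).
Notation inw i j := (inward G (r i) (r j) (phi j - phi i)).

Lemma inwardN y z a : inward G y z (- a) = inward G y z a.
Proof. by rewrite /inward cosN. Qed.

Lemma inw_sym i j : inward G (r i) (r j) (phi i - phi j) = inw i j.
Proof. by rewrite -inwardN opprB. Qed.

Lemma sine_coned_ge0 i j : (i <= j)%N -> (j <= M)%N -> 0 <= S (cd i j).
Proof.
move=> ij jM; have iM := leq_trans ij jM; apply: sine_ge0; last exact: (coned_lt C).
by apply: coned_ge0; apply: (cone_ge0 C).
Qed.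

Lemma side_lt_hlen i : (i < M)%N -> s i < H.
Proof. by move=> iM; rewrite -(coned_side C iM) (coned_lt C). Qed.

Lemma sine_side_gt0 i : (i < M)%N -> 0 < S (s i).
Proof.
by move=> iM; apply: sine_gt0; [exact: (cone_side_gt0 C)|exact: side_lt_hlen].
Qed.

Lemma stewart_cone i : (i.+1 < M)%N ->
  stewart G (s i) (s i.+1) (r i.+1) (r i) (r i.+2) =
  S (r i.+1) * (inw i.+1 i * S (s i.+1) + inw i.+1 i.+2 * S (s i)).
Proof.
move=> iM; apply: stewart_inward; last exact: (cone_chord C).
by rewrite (cone_chord C (ltnW iM)) chordC -chordN opprB.
Qed.

Section Convexity.
Hypothesis convex : forall i, (i.+1 < M)%N ->
  0 <= stewart G (s i) (s i.+1) (r i.+1) (r i) (r i.+2).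

Lemma convex_local i : (i.+1 < M)%N -> 0 < r i.+1 ->
  0 <= inw i.+1 i * S (s i.+1) + inw i.+1 i.+2 * S (s i).
Proof.
move=> iM r0; have := convex iM; rewrite stewart_cone // pmulr_rge0 //.
by apply: sine_gt0 => //; exact: (cone_lt C (ltnW iM)).
Qed.

(** The bound at [k.+1] turns local convexity there into convexity of the broken line [i], [k.+1],
    [k.+2]; [inward_mono] then gives the bound at [k.+2]. In angles: the apex makes no larger an
    angle with a farther vertex than with the neighbour. *)
Lemma inw_left i k : (i <= k)%N -> (k < M)%N -> phi k.+1 - phi i < pi ->
  inw k.+1 k * S (cd i k.+1) <= inw k.+1 i * S (s k).
Proof.
elim: k => [|k IH].
  by rewrite leqn0 => /eqP-> M0 _; rewrite (coned_side C M0).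
rewrite leq_eqVlt => /orP[/eqP-> kM _|ik kM h]; first by rewrite (coned_side C kM).
have ik' : (i <= k)%N by []; have kM' := ltnW kM; have kM2 := ltnW kM'.
have iM := leq_trans ik' kM2.
have step := cone_step C kM.
have h' : phi k.+1 - phi i < pi by move: h step; clear -C; lra.
have {}IH := IH ik' kM' h'.
have ik2 : (i < k.+2)%N by apply: leqW.
have pos m : (i <= m)%N -> (m <= k.+2)%N -> 0 < r m.
  by move=> im mk; apply: (cone_apex_gt0 C ik2 kM h).
have ri := pos _ (leqnn _) (ltnW ik2); have rk := pos _ (leqW ik') (leqnSn _).
have rk2 := pos _ (ltnW ik2) (leqnn _).
have loc := convex_local kM rk.
have Sk := sine_side_gt0 kM'; have Sc := sine_coned_ge0 (leqW ik') kM'.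
have e : phi k.+2 - phi i = (phi k.+1 - phi i) + (phi k.+2 - phi k.+1) by ring.
have c0 i' j' : (i' <= M)%N -> (j' <= M)%N -> 0 <= cd i' j'.
  by move=> *; apply: coned_ge0; apply: (cone_ge0 C).
have a0 : 0 <= phi k.+1 - phi i by rewrite subr_ge0 (cone_mono C (leqW ik') kM').
have b0 : 0 <= phi k.+2 - phi k.+1 by rewrite subr_ge0.
have abpi : phi k.+1 - phi i + (phi k.+2 - phi k.+1) < pi by rewrite -e.
have es : q (cd i k.+1) = chord G (r k.+1) (r i) (phi k.+1 - phi i).
  by rewrite (vers_coned C iM kM' h') chordC.
have ex : q (cd i k.+2) =
    chord G (r k.+2) (r i) (phi k.+1 - phi i + (phi k.+2 - phi k.+1)).
  by rewrite -e (vers_coned C iM kM h) chordC.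
have := inward_mono ri (cone_lt C iM) rk (cone_lt C kM') rk2 (cone_lt C kM)
  a0 b0 abpi (c0 _ _ iM kM') (coned_lt C (leqW ik') kM')
  (cone_side_gt0 C kM) (side_lt_hlen kM) (c0 _ _ iM kM)
  (coned_lt C (ltnW ik2) kM) es (cone_chord C kM) ex.
rewrite -e !inw_sym; apply.
apply: transfer_ge0 (sine_side_gt0 kM') (ltW (sine_side_gt0 kM)) Sc IH loc.
Qed.

(** The mirror image of [inw_left]. The far end stays fixed while the vertex moves, hence the
    induction on the number [n] of steps between them. *)
Lemma inw_right n k : (k + n.+1 <= M)%N -> phi (k + n.+1)%N - phi k < pi ->
  inw k k.+1 * S (cd k (k + n.+1)%N) <= inw k (k + n.+1)%N * S (s k).
Proof.
elim: n k => [|n IH] k; first by rewrite addn1 => kM _; rewrite (coned_side C kM).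
set j := (k + n.+2)%N => jM h.
have ej : (k.+1 + n.+1)%N = j by rewrite addSnnS.
have kj : (k.+1 < j)%N by rewrite /j; lia.
have kM : (k.+1 < M)%N by lia.
have kM' := ltnW kM; have k0M := ltnW kM'.
have step := cone_step C kM'.
have h' : phi j - phi k.+1 < pi by move: h step; clear -C; lra.
have {}IH := IH k.+1; rewrite ej in IH; have {}IH := IH jM h'.
have pos m : (k <= m)%N -> (m <= j)%N -> 0 < r m.
  by move=> km mj; apply: (cone_apex_gt0 C _ jM h) => //; exact: ltnW.
have rj := pos j (ltnW (ltnW kj)) (leqnn _).
have rk := pos k (leqnn _) (ltnW (ltnW kj)); have rk1 := pos k.+1 (leqnSn _) (ltnW kj).
have loc := convex_local kM rk1.
have Sc := sine_coned_ge0 (ltnW kj) jM.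
have c0 i' j' : (i' <= M)%N -> (j' <= M)%N -> 0 <= cd i' j'.
  by move=> *; apply: coned_ge0; apply: (cone_ge0 C).
have e : phi j - phi k = (phi j - phi k.+1) + (phi k.+1 - phi k) by ring.
have a0 : 0 <= phi j - phi k.+1 by rewrite subr_ge0 (cone_mono C (ltnW kj) jM).
have b0 : 0 <= phi k.+1 - phi k by rewrite subr_ge0.
have abpi : phi j - phi k.+1 + (phi k.+1 - phi k) < pi by rewrite -e.
have es := vers_coned C kM' jM h'.
have et : q (s k) = chord G (r k.+1) (r k) (phi k.+1 - phi k).
  by rewrite (cone_chord C kM') chordC.
have ex := vers_coned C k0M jM h; rewrite e in ex.
have := inward_mono rj (cone_lt C jM) rk1 (cone_lt C kM') rk (cone_lt C k0M)
  a0 b0 abpi (c0 _ _ kM' jM) (coned_lt C (ltnW kj) jM)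
  (cone_side_gt0 C kM') (side_lt_hlen kM') (c0 _ _ k0M jM)
  (coned_lt C (ltnW (ltnW kj)) jM) es et.
rewrite -e !inw_sym; apply; first by rewrite e.
apply: transfer_ge0 (sine_side_gt0 kM) (ltW (sine_side_gt0 kM')) Sc IH _.
by rewrite addrC.
Qed.

(** Local convexity at k is carried to distant vertices by two transfers, one on each side. *)
Lemma inw_convex i k j : (i < k)%N -> (k < j)%N -> (j <= M)%N ->
  phi j - phi i < pi -> 0 <= inw k i * S (cd k j) + inw k j * S (cd i k).
Proof.
case: k => // k ik kj jM h.
have ij : (i < j)%N by apply: ltn_trans kj.
have pos : 0 < r k.+1 by apply: (cone_apex_gt0 C ij jM h); exact: ltnW.
have kM : (k.+1 < M)%N by apply: leq_trans jM.
have hi : phi k.+1 - phi i < pi.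
  by have := cone_mono C (ltnW kj) jM; move: h; clear -C; lra.
have hj : phi j - phi k.+1 < pi.
  by have := cone_mono C (ltnW ik) (ltnW kM); move: h; clear -C; lra.
have il := @inw_left i k ik (ltnW kM) hi.
have ej : (k.+1 + (j - k.+2).+1)%N = j by lia.
have ir := @inw_right (j - k.+2)%N k.+1; rewrite ej in ir; have {}ir := ir jM hj.
have loc := convex_local kM pos.
have Sc := sine_coned_ge0 (ltnW ik) (ltnW kM).
have Sc' := sine_coned_ge0 (ltnW kj) jM.
have Sk := sine_side_gt0 (ltnW kM); have Sk' := sine_side_gt0 kM.
have step1 := transfer_ge0 Sk (ltW Sk') Sc il loc.
rewrite addrC; apply: transfer_ge0 Sk' Sc Sc' ir _; by rewrite addrC.
Qed.

End Convexity.

(** The second conjunct carries the induction: from [m.+1] the start [i] is seen in the direction of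
    the last vertex [m], so straightness at [m.+1] prolongs the whole run. *)
Lemma straight_run i m : (i <= m)%N -> (m < M)%N -> phi m.+1 - phi i < pi ->
  (forall k, (i <= k)%N -> (k < m)%N ->
    stewart G (s k) (s k.+1) (r k.+1) (r k) (r k.+2) = 0) ->
  cd i m.+1 = x m.+1 - x i /\ inw m.+1 i * S (s m) = inw m.+1 m * S (cd i m.+1).
Proof.
elim: m => [|m IH].
  rewrite leqn0 => /eqP-> M0 _ _; rewrite (coned_side C M0) (cone_pos C M0).
  by split=> //; ring.
rewrite leq_eqVlt => /orP[/eqP-> mM _ _|im mM h str].
  by rewrite (coned_side C mM) (cone_pos C mM); split=> //; ring.
have im' : (i <= m)%N by []; have mM' := ltnW mM; have iM := leq_trans im' (ltnW mM').
have step := cone_step C mM.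
have h' : phi m.+1 - phi i < pi by move: h step; clear -C; lra.
have [|e1 e2] := IH im' mM' h'; first by move=> k ik km; apply: str => //; exact: ltnW.
have im2 : (i < m.+2)%N by apply: leqW.
have rm := cone_apex_gt0 C im2 mM h (leqW im') (leqnSn _).
have rm2 := cone_apex_gt0 C im2 mM h (ltnW im2) (leqnn _).
have ri := cone_apex_gt0 C im2 mM h (leqnn _) (ltnW im2).
have Srm := sine_gt0 rm (cone_lt C mM').
have Srm2 := sine_gt0 rm2 (cone_lt C mM).
have Sm := sine_side_gt0 mM'; have Sm' := sine_side_gt0 mM.
have st0 := str m im' (ltnSn m).
have {}st0 : inw m.+1 m * S (s m.+1) + inw m.+1 m.+2 * S (s m) = 0.
  by move: st0; rewrite stewart_cone // => /eqP; rewrite mulf_eq0 gt_eqF //= => /eqP.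
have c0 : 0 < cd i m.+1.
  rewrite e1 (cone_pos C mM').
  by have := cone_pos_mono C im' (ltnW mM'); have := cone_side_gt0 C mM'; clear -C; lra.
have Sc := sine_gt0 c0 (coned_lt C (leqW im') mM').
have {}st0 : inw m.+1 i * S (s m.+1) + inw m.+1 m.+2 * S (cd i m.+1) = 0.
  apply: (mulfI (lt0r_neq0 Sm)); rewrite mulr0.
  transitivity (inw m.+1 i * S (s m) * S (s m.+1) +
    inw m.+1 m.+2 * S (s m) * S (cd i m.+1)); first by ring.
  rewrite e2; transitivity (S (cd i m.+1) *
    (inw m.+1 m * S (s m.+1) + inw m.+1 m.+2 * S (s m))); first by ring.
  by rewrite st0 mulr0.
have e : phi m.+2 - phi i = (phi m.+1 - phi i) + (phi m.+2 - phi m.+1) by ring.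
have es : q (cd i m.+1) = chord G (r m.+1) (r i) (phi m.+1 - phi i).
  by rewrite (vers_coned C iM mM' h') chordC.
have et := cone_chord C mM.
have a0 : 0 <= phi m.+1 - phi i by rewrite subr_ge0 (cone_mono C (leqW im') mM').
have b0 : 0 <= phi m.+2 - phi m.+1 by rewrite subr_ge0.
rewrite -!(inw_sym m.+2).
move: st0; rewrite -(inw_sym m.+1 i) => st0.
have ch : chord G (r i) (r m.+2) (phi m.+1 - phi i + (phi m.+2 - phi m.+1)) =
    q (cd i m.+1 + s m.+1).
  apply: (chord_straight _ _ Sc Sm' es et st0).
    exact: sine_inward_ge0 (ltW ri) (cone_lt C iM) a0 (ltW h').
  exact: sine_inward_ge0 (ltW rm2) (cone_lt C mM) b0 (cone_step_pi C mM).
have ec : cd i m.+2 = cd i m.+1 + s m.+1.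
  apply: (@vers_inj _ G).
  - by apply: coned_ge0; rewrite ltW.
  - by rewrite addr_ge0 ?ltW // (cone_side_gt0 C).
  - rewrite e1; have := coned_le_add (phi m.+2 - phi i) (ltW ri)
      (ltW (cone_lt C iM)) (ltW rm2) (ltW (cone_lt C mM)).
    have := cone_perim C; have := cone_le C iM; have := cone_leC C mM.
    by have := cone_pos C mM; clear -C; lra.
  - by rewrite (vers_coned C iM mM h) e ch.
split; first by rewrite ec e1 (cone_pos C mM); ring.
rewrite ec e; apply: (@inward_straight _ G (r i) (r m.+1) (r m.+2) (phi m.+1 - phi i)).
- exact: Srm2.
- by rewrite et chordC.
- by rewrite chordC ch.
- by rewrite (stewart_inward es et) st0 mulr0.
Qed.

Lemma side_sum_le (w : nat -> nat -> R) :
  (forall i, (i < M)%N -> w i i.+1 = s i) ->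
  (forall i k j, (i <= k)%N -> (k <= j)%N -> (j <= M)%N -> w i j <= w i k + w k j) ->
  forall i j, (i < j)%N -> (j <= M)%N -> w i j <= x j - x i.
Proof.
move=> w_side w_triangle i; elim=> // j IH.
rewrite ltnS leq_eqVlt => /orP[/eqP-> jM|ij jM].
  by rewrite w_side // (cone_pos C jM) addrAC subrr add0r.
have := w_triangle _ _ _ (ltnW ij) (leqnSn j) jM; have := IH ij (ltnW jM).
by rewrite w_side // (cone_pos C jM); clear -C; lra.
Qed.

(** Induction on [j - i]. The geodesic passes through the apex, or the chain from i to j is
    straight, or some k in between touches the obstacle. In the last case the induction hypotheses
    bound the sides at k of the figure from [w_quad] by those in the cone, and [quad_le] bounds its
    diagonal. *)
Lemma fan_lower_bound (o : nat -> R) (w : nat -> nat -> R) :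
  (forall i, (i.+1 < M)%N ->
    0 <= stewart G (s i) (s i.+1) (r i.+1) (r i) (r i.+2)) ->
  (forall i, (i <= M)%N -> o i <= r i) ->
  (forall i, (i.+1 < M)%N -> o i.+1 < r i.+1 ->
    stewart G (s i) (s i.+1) (r i.+1) (r i) (r i.+2) = 0) ->
  (forall i, (i < M)%N -> w i i.+1 = s i) ->
  (forall i k j, (i <= k)%N -> (k <= j)%N -> (j <= M)%N -> w i j <= w i k + w k j) ->
  (forall i j, (i <= j)%N -> (j <= M)%N -> w i j <= o i + o j) ->
  (forall i k j, (i < k)%N -> (k < j)%N -> (j <= M)%N ->
    exists p a c b : G,
      [/\ d p a <= o i, d a c <= w i k, d c b <= w k j, d p b <= o j &
          o k <= d p c /\ w i j <= d a b]) ->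
  forall i j, (i < j)%N -> (j <= M)%N -> w i j <= cd i j.
Proof.
move=> convex o_le straight w_side w_triangle w_apex w_quad i j.
move: {2}(j - i)%N (leqnn (j - i)%N) => n; elim: n i j => [|n IH] i j hn ij jM.
  by move: hn; rewrite leqn0 subn_eq0 leqNgt ij.
have iM := leq_trans (ltnW ij) jM.
have [h|h] := ltP (phi j - phi i) pi; last first.
  rewrite /coned ltNge h /=; apply: le_trans (w_apex _ _ (ltnW ij) jM) _.
  by rewrite lerD ?o_le.
have [[k /andP[ik kj] kc]|nex] :=
  pselect (exists2 k, (i < k < j)%N & r k <= o k); last first.
  have e1 : j.-1.+1 = j by rewrite prednK // (leq_trans _ ij).
  have ij1 : (i <= j.-1)%N by rewrite -ltnS e1.
  have := @straight_run i j.-1 ij1; rewrite e1 => /(_ _ h)[] //.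
  - move=> k ik kj; apply: straight; first by rewrite (leq_trans _ jM) // -e1 ltnS.
    rewrite ltNge; apply/negP => rk; apply: nex; exists k.+1 => //.
    by rewrite ltnS ik -e1 ltnS.
  by move=> -> _; apply: side_sum_le.
have kM := ltnW (leq_trans kj jM).
have [p [a [c [b [pa ac cb pb [pc ab]]]]]] := w_quad _ _ _ ik kj jM.
have pos m : (i <= m)%N -> (m <= j)%N -> 0 < r m.
  by move=> im mj; apply: (cone_apex_gt0 C ij jM h).
have ri := pos i (leqnn _) (ltnW ij); have rj := pos j (ltnW ij) (leqnn _).
have rk := pos k (ltnW ik) (ltnW kj).
have riH := cone_lt C iM; have rjH := cone_lt C jM; have rkH := cone_lt C kM.
have a0 : 0 <= phi k - phi i by rewrite subr_ge0 (cone_mono C (ltnW ik) kM).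
have b0 : 0 <= phi j - phi k by rewrite subr_ge0 (cone_mono C (ltnW kj) jM).
have e : phi j - phi i = (phi k - phi i) + (phi j - phi k) by ring.
have hi : phi k - phi i < pi by move: h b0; rewrite e; clear -C; lra.
have hj : phi j - phi k < pi by move: h a0; rewrite e; clear -C; lra.
have c0 i' j' : (i' <= M)%N -> (j' <= M)%N -> 0 <= cd i' j'.
  by move=> *; apply: coned_ge0; apply: (cone_ge0 C).
have es : q (cd i k) = chord G (r k) (r i) (phi k - phi i).
  by rewrite (vers_coned C iM kM hi) chordC.
have et := vers_coned C kM jM hj.
have wik : w i k <= cd i k.
  by apply: IH => //; rewrite -ltnS (leq_trans _ hn) // ltn_sub2r.
have wkj : w k j <= cd k j.
  by apply: IH => //; rewrite -ltnS (leq_trans _ hn) // ltn_sub2l.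
apply: le_trans ab _; rewrite /coned h -vers_pdist.
rewrite (vers_polard (ltW ri) (ltW riH) (ltW rj) (ltW rjH)) e.
have cx := inw_convex convex ik kj jM h; rewrite -(inw_sym k i) in cx.
have vle u v y : d u v <= y -> y <= cd i k -> q (d u v) <= q (cd i k).
  by move=> uy yc; rewrite /coned hi vers_pdist (le_trans uy) // (le_trans yc) // /coned hi.
apply: (@quad_le _ G p a c b (r i) (r k) (r j) _ _ (cd i k) (cd k j)) => //.
- by rewrite -e.
- exact: c0.
- exact: (coned_lt C (ltnW ik) kM).
- exact: c0.
- exact: (coned_lt C (ltnW kj) jM).
- by rewrite (vers_pdist_le _ _ (ltW ri) (ltW riH)) (le_trans pa) // o_le.
- by rewrite (vers_pdist_le _ _ (ltW rj) (ltW rjH)) (le_trans pb) // o_le.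
- by rewrite (vers_le_pdist _ _ (ltW rk) (ltW rkH)) (le_trans kc).
- by rewrite -es; apply: vle ac wik.
- by rewrite -et /coned hj vers_pdist (le_trans cb) // (le_trans wkj) // /coned hj.
Qed.

End ConvexChain.

(* A triangle with a vertex at the apex has no angle there; giving it the angle
   pi keeps all chords correct and makes the cone wide around such a vertex. *)
Lemma fan_exists (R : realType) (G : plane_geometry R) M (o s x : nat -> R) (L : R) :
  obstacle_data G M o s x L ->
  exists r phi, [/\ cone_chain G M r phi s x L,
    r 0%N = o 0%N, r M = o M, forall i, (i <= M)%N -> o i <= r i &
    (forall i, (i.+1 < M)%N ->
      0 <= stewart G (s i) (s i.+1) (r i.+1) (r i) (r i.+2)) /\
    (forall i, (i.+1 < M)%N -> o i.+1 < r i.+1 ->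
      stewart G (s i) (s i.+1) (r i.+1) (r i) (r i.+2) = 0)].
Proof.
move=> C; have [r rP str] := obstacle_solution C.
have [ro r_0 r_M rs conv] := rP.
pose cs i := 1 - (vers G (s i) - vers G (r i - r i.+1)) / (sine G (r i) * sine G (r i.+1)).
pose th i := if (r i == 0) || (r i.+1 == 0) then pi else acos (cs i).
exists r, (fun i => \sum_(m < i) th m).
have step i : \sum_(m < i.+1) th m - \sum_(m < i) th m = th i.
  by rewrite big_ord_recr /= addrAC subrr add0r.
have r_ge0 i : (i <= M)%N -> 0 <= r i.
  by move=> iM; apply: le_trans (obs_ge0 C iM) (ro i iM).
have r_lt i : (i <= M)%N -> r i < hlen G.
  by move=> iM; have := admissible_le C rP iM; have := perim_lt C; clear; lra.
have s_le i : (i < M)%N -> s i <= r i + r i.+1.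
  move=> iM; have := side_le C iM; have := ro _ (ltnW iM); have := ro _ iM.
  by clear; lra.
have csP i : (i < M)%N -> 0 < r i -> 0 < r i.+1 -> -1 <= cs i <= 1.
  move=> iM r0 r1; have iM' := ltnW iM; have [h1 h2] := rs _ iM.
  have Sr := sine_gt0 r0 (r_lt _ iM'); have Sr' := sine_gt0 r1 (r_lt _ iM).
  have SS := mulr_gt0 Sr Sr'; have s0 := side_gt0 C iM; have sH := side_lt C iM.
  have u1 : vers G (r i - r i.+1) <= vers G (s i).
    have u : `|r i - r i.+1| <= s i by rewrite ler_norml; move: h1 h2; clear; lra.
    by rewrite -vers_norm; apply: vers_le => //; move: sH u; clear; lra.
  have u2 : vers G (s i) <= vers G (r i - r i.+1) + 2 * (sine G (r i) * sine G (r i.+1)).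
    have -> : vers G (r i - r i.+1) + 2 * (sine G (r i) * sine G (r i.+1)) =
      vers G (r i + r i.+1) by rewrite versB versD; ring.
    apply: vers_le; [exact: ltW|exact: s_le|].
    have := admissible_le C rP iM; have := admissible_le C rP iM'.
    by have := posS C iM; have := perim_lt C; clear; lra.
  rewrite /cs; apply/andP; split.
    rewrite lerBrDr -lerBrDl opprK ler_pdivrMr //.
    by move: u2; clear; lra.
  by rewrite gerBl divr_ge0 ?(ltW SS) // subr_ge0.
have thP i : (i < M)%N -> 0 <= th i <= pi.
  move=> iM; rewrite /th; case: ifP => [_|/negbT]; first by rewrite pi_ge0 lexx.
  rewrite negb_or => /andP[r0 r1]; have : -1 <= cs i <= 1.
    by apply: csP => //; rewrite lt0r ?r0 ?r1 r_ge0 // ltnW.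
  by move=> h; rewrite acos_ge0 // acos_lepi.
split=> //; split.
- exact: perim_lt C.
- exact: r_ge0.
- by move=> i iM; have [] := admissible_le C rP iM.
- by move=> i iM; have [] := admissible_le C rP iM.
- exact: posS C.
- exact: side_gt0 C.
- by move=> i iM; rewrite -subr_ge0 step; have /andP[] := thP _ iM.
- by move=> i iM; rewrite step; have /andP[] := thP _ iM.
- move=> i iM; rewrite step /th; case: ifP => [/orP h|/negbT].
    rewrite chordpi; congr (vers G _); have [h1 h2] := rs _ iM; have := s_le _ iM.
    by case: h => /eqP e; move: h1 h2; rewrite e; clear; lra.
  rewrite negb_or => /andP[r0 r1]; have iM' := ltnW iM.
  have p0 : 0 < r i by rewrite lt0r r0 r_ge0.
  have p1 : 0 < r i.+1 by rewrite lt0r r1 r_ge0.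
  have Sr := sine_gt0 p0 (r_lt _ iM'); have Sr' := sine_gt0 p1 (r_lt _ iM).
  rewrite /chord acosK ?in_itv /= ?csP // /cs.
  by field; rewrite !gt_eqF.
- move=> i iM h; rewrite step /th; case: ifP => // /negbT; rewrite negb_or.
  by case: h => ->; rewrite eqxx // andbF.
Qed.

(** * Comparison quadrilaterals of a cone *)

Section ConeQuads.
Variables (R : realType) (G : plane_geometry R).
Notation d := (@pdist R G).
Notation H := (hlen G).

Definition comparison (w : nat -> nat -> R) (i j k l : nat) : Prop :=
  exists a b c e : G,
    [/\ d a b <= w i j, d b c <= w j k, d c e <= w k l, d a e <= w i l &
        w i k <= d a c /\ w j l <= d b e].

Lemma polard_le_coned r r' a b : 0 <= r -> r < H -> 0 <= r' -> r' < H ->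
  0 <= a -> a <= b -> a <= pi -> polard G r r' a <= coned G r r' b.
Proof.
move=> r0 rH r'0 r'H a0 ab api; rewrite /coned; case: ifP => bpi.
  by apply: polard_mono => //; exact: ltW.
by apply: polard_le_add => //; exact: ltW.
Qed.

Variables (M : nat) (r phi s x : nat -> R) (L : R).
Hypothesis C : cone_chain G M r phi s x L.
Notation cd i j := (coned G (r i) (r j) (phi j - phi i)).

Lemma polard_pi_cone i j : (i <= j)%N -> (j <= M)%N -> pi <= phi j - phi i ->
  polard G (r i) (r j) pi = r i + r j.
Proof.
move=> ij jM h; have iM := leq_trans ij jM.
have riH := ltW (cone_lt C iM); have rjH := ltW (cone_lt C jM).
apply: polard_pi; rewrite ?(cone_ge0 C) //.
have := polard_le_add (cone_ge0 C iM) riH (cone_ge0 C jM) rjH pi.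
have := cone_pi_le C ij jM h; have := cone_le C iM; have := cone_leC C jM.
by have := cone_perim C; clear -C; lra.
Qed.

Lemma coned_polard i j : (i <= j)%N -> (j <= M)%N -> phi j - phi i <= pi ->
  polard G (r i) (r j) (phi j - phi i) = cd i j.
Proof.
move=> ij jM; rewrite /coned le_eqVlt => /orP[/eqP e|-> //].
by rewrite e ltxx polard_pi_cone // e.
Qed.

(* Open the angles at the apex as far as a planar picture allows: the middle
   sector first, then the outer ones until each diagonal is straight. *)
Lemma cone_comparison i j k l : (i < j)%N -> (j < k)%N -> (k < l)%N -> (l <= M)%N ->
  comparison (fun i j => cd i j) i j k l.
Proof.
move=> ij jk kl lM; have kM := leq_trans (ltnW kl) lM.
have jM := leq_trans (ltnW jk) kM; have iM := leq_trans (ltnW ij) jM.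
have [[[ri rj] rk] rl] := (cone_ge0 C iM, cone_ge0 C jM, cone_ge0 C kM, cone_ge0 C lM).
have [[[riH rjH] rkH] rlH] := (cone_lt C iM, cone_lt C jM, cone_lt C kM, cone_lt C lM).
have a0 : 0 <= phi j - phi i by rewrite subr_ge0 (cone_mono C (ltnW ij)).
have b0 : 0 <= phi k - phi j by rewrite subr_ge0 (cone_mono C (ltnW jk)).
have c0 : 0 <= phi l - phi k by rewrite subr_ge0 (cone_mono C (ltnW kl)).
have eik : phi k - phi i = (phi j - phi i) + (phi k - phi j) by ring.
have ejl : phi l - phi j = (phi k - phi j) + (phi l - phi k) by ring.
have eil : phi l - phi i = (phi j - phi i) + (phi k - phi j) + (phi l - phi k) by ring.
have pik := polard_pi_cone (ltnW (ltn_trans ij jk)) kM.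
have pjl := polard_pi_cone (ltnW (ltn_trans jk kl)) lM.
rewrite /comparison eik ejl eil; rewrite eik in pik; rewrite ejl in pjl.
move: (phi j - phi i) (phi k - phi j) (phi l - phi k) a0 b0 c0 pik pjl.
move=> al be ga a0 b0 c0 pik pjl {eik ejl eil}.
pose be' := Num.min be pi; pose al' := Num.min al (pi - be').
pose ga' := Num.min ga (pi - be').
have [be1 be2 be3] : [/\ 0 <= be', be' <= be & be' <= pi].
  by split; rewrite /be' ?le_min ?b0 ?pi_ge0 // ge_min lexx ?orbT.
have [al1 al2 al3] : [/\ 0 <= al', al' <= al & al' <= pi - be'].
  by split; rewrite /al' ?le_min ?a0 ?subr_ge0 // ge_min lexx ?orbT.
have [ga1 ga2 ga3] : [/\ 0 <= ga', ga' <= ga & ga' <= pi - be'].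
  by split; rewrite /ga' ?le_min ?c0 ?subr_ge0 // ge_min lexx ?orbT.
have be_eq : be <= pi -> be' = be by move=> ?; exact/min_idPl.
have be_eq' : pi <= be -> be' = pi by move=> ?; exact/min_idPr.
have sum_eq t : 0 <= t -> t + be < pi -> Num.min t (pi - be') + be' = t + be.
  move=> t0 h; have -> : be' = be by apply: be_eq; move: h t0; clear -C; lra.
  by congr (_ + be); apply/min_idPl; move: h; clear -C; lra.
have sum_eq' t : 0 <= t -> pi <= t + be -> Num.min t (pi - be') + be' = pi.
  move=> t0 h; rewrite (_ : Num.min _ _ = pi - be'); first by rewrite subrK.
  apply/min_idPr; have [hb|hb] := leP be pi; first by rewrite be_eq //; move: h; clear -C; lra.
  by rewrite be_eq' ?subrr // ltW.
exists (polar G (r i) 0), (polar G (r j) al'), (polar G (r k) (al' + be')),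
  (polar G (r l) (al' + be' + ga')).
have [[[riH' rjH'] rkH'] rlH'] := (ltW riH, ltW rjH, ltW rkH, ltW rlH).
have r1 : al' + be' - al' = be' by ring.
have r2 : al' + be' + ga' - (al' + be') = ga' by ring.
have r3 : al' + be' + ga' - al' = ga' + be' by ring.
rewrite !pdist_polar // !subr0 r1 r2 r3.
split.
- by apply: polard_le_coned => //; move: al3 be1; clear -C; lra.
- exact: polard_le_coned.
- by apply: polard_le_coned => //; move: ga3 be1; clear -C; lra.
(* For total angle at least pi, the outer side in the cone passes through the apex and bounds any
   planar picture; otherwise no angle was truncated. *)
- have [h|h] := ltP (al + be + ga) pi; last first.
    by rewrite /coned ltNge h /=; exact: polard_le_add.
  have e1 : al' + be' = al + be by apply: sum_eq => //; move: h c0; clear -C; lra.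
  have e2 : ga' + be' = ga + be by apply: sum_eq => //; move: h a0; clear -C; lra.
  have e3 : be' = be by apply: be_eq; move: h a0 c0; clear -C; lra.
  have -> : al' + be' + ga' = al + be + ga by move: e1 e2 e3; clear -C; lra.
  by rewrite /coned h.
- split.
    have [h|h] := ltP (al + be) pi; first by rewrite sum_eq // /coned h.
    by rewrite sum_eq' // /coned ltNge h pik.
  rewrite [be + ga]addrC; rewrite [be + ga]addrC in pjl.
  have [h|h] := ltP (ga + be) pi; first by rewrite sum_eq // /coned h.
  by rewrite sum_eq' // /coned ltNge h pjl.
Qed.

End ConeQuads.

(** * Unfolding a polygon *)

(** [w] is a pseudometric on the vertices 0, ..., N, read for [i <= j] only, whence the three
    triangle inequalities. [x] measures length along the sides, and [w 0%N N] closes the polygon. *)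
Record polygon (R : realType) (G : plane_geometry R) (N : nat)
    (w : nat -> nat -> R) (x : nat -> R) : Prop := Polygon {
  poly_pos0 : x 0%N = 0;
  poly_posS : forall i, (i < N)%N -> x i.+1 = x i + w i i.+1;
  poly_perim : x N + w 0%N N < 2 * hlen G;
  polyxx : forall i, (i <= N)%N -> w i i = 0;
  poly_triangle : forall i k j, (i <= k)%N -> (k <= j)%N -> (j <= N)%N ->
    [/\ w i j <= w i k + w k j, w i k <= w i j + w k j & w k j <= w i k + w i j];
  poly_comparison : forall i j k l, (i < j)%N -> (j < k)%N -> (k < l)%N ->
    (l <= N)%N -> comparison G w i j k l
}.

(** Sides are equal and not merely bounded: in the induction the closing side must have length
    [r 0%N + r M] for the apex to be placed on it. *)
Definition unfolds (R : realType) (G : plane_geometry R) (N : nat)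
    (w : nat -> nat -> R) : Prop :=
  exists g : nat -> G, [/\ forall i, (i < N)%N -> pdist (g i) (g i.+1) = w i i.+1,
    pdist (g 0%N) (g N) = w 0%N N &
    forall i j, (i < j)%N -> (j <= N)%N -> w i j <= pdist (g i) (g j)].

Section Polygon.
Variables (R : realType) (G : plane_geometry R).
Notation d := (@pdist R G).
Notation q := (vers G).
Notation S := (sine G).
Notation H := (hlen G).

Lemma poly_ge0 N w x i j : polygon G N w x -> (i <= j)%N -> (j <= N)%N -> 0 <= w i j.
Proof.
move=> P ij jN; have [_] := poly_triangle P (leqnn i) ij jN.
by rewrite (polyxx P) ?(leq_trans ij) //; clear; lra.
Qed.

Lemma poly_le_pos N w x i j : polygon G N w x -> (i <= j)%N -> (j <= N)%N ->
  w i j <= x j - x i.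
Proof.
move=> P; elim: j => [|j IH]; first by rewrite leqn0 => /eqP-> N0; rewrite (polyxx P) // subrr.
rewrite leq_eqVlt => /orP[/eqP-> jN|ij jN]; first by rewrite (polyxx P) // subrr.
have [+ _ _] := poly_triangle P (i := i) ij (leqnSn j) jN; have := IH ij (ltnW jN).
by rewrite (poly_posS P jN); clear; lra.
Qed.

(** The vertices [e] and [e.+1] have the same distances to all the others, so one point can serve
    for both. *)
Lemma delete_vertex N w x e : polygon G N.+1 w x -> (0 < e)%N -> (e <= N)%N -> w e e.+1 = 0 ->
  (forall w' x', polygon G N w' x' -> unfolds G N w') -> unfolds G N.+1 w.
Proof.
move=> P e0 eN we IH.
have wl i : (i <= e)%N -> w i e = w i e.+1.
  move=> ie; have [+ + _] := poly_triangle P ie (leqnSn e) eN; rewrite we.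
  by clear; lra.
have wr j : (e < j)%N -> (j <= N.+1)%N -> w e j = w e.+1 j.
  move=> ej jN; have [+ _ +] := poly_triangle P (leqnSn e) ej jN; rewrite we.
  by clear; lra.
(* [u] skips the index [e.+1]; [v] sends both [e] and [e.+1] to [e] and closes the gap. *)
pose u i := bump e.+1 i; pose v i := if (i <= e)%N then i else i.-1.
have u_le i j : (i <= j)%N -> (u i <= u j)%N by rewrite /u leq_bump2.
have uN i : (i <= N)%N -> (u i <= N.+1)%N by rewrite /u /bump; lia.
have u_lt i j : (i < j)%N -> (u i < u j)%N by rewrite /u /bump; lia.
have u0 : u 0%N = 0%N by [].
have ule i : (i <= e)%N -> u i = i by move=> ie; rewrite /u /bump ltnNge ie.
have ugt i : (e < i)%N -> u i = i.+1 by move=> ie; rewrite /u /bump ie.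
have uv i : i != e.+1 -> u (v i) = i.
  move=> ne; rewrite /v; case: leqP => ie; first exact: ule.
  have i0 : i.-1.+1 = i by rewrite prednK // (leq_ltn_trans _ ie).
  by rewrite ugt // -ltnS i0 ltn_neqAle eq_sym ne.
have uve : u (v e.+1) = e by rewrite /v ltnn /= ule.
have wuv i j : (i < j)%N -> (j <= N.+1)%N -> (i != e) || (j != e.+1) ->
    w (u (v i)) (u (v j)) = w i j.
  move=> ij jN ne; case: (eqVneq i e.+1) => [ei|ni].
    rewrite ei uve uv; last by rewrite gtn_eqF // -ei.
    by rewrite wr // -ei ltnW.
  rewrite (uv i) //; case: (eqVneq j e.+1) => [ej|nj]; last by rewrite uv.
  by rewrite ej uve wl // -ltnS -ej.
have [|g [g1 g2 g3]] := IH (fun i j => w (u i) (u j)) (x \o u).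
  split.
  - exact: poly_pos0 P.
  - move=> i iN; rewrite /=; case: (ltngtP i e) => ie.
    + by rewrite (ule _ ie) (ule _ (ltnW ie)) (poly_posS P) // ltnW.
    + by rewrite (ugt _ ie) (ugt _ (leqW ie)) (poly_posS P).
    + rewrite ie (ule _ (leqnn e)) (ugt _ (ltnSn e)) (poly_posS P); last by rewrite -ie.
      by rewrite (poly_posS P) // we addr0 wr // -ie.
  - rewrite /= u0; move: (eN); rewrite leq_eqVlt => /orP[/eqP e1|e1].
      have := poly_perim P; rewrite (poly_posS P (ltnSn _)) -e1 we addr0.
      by rewrite ule // wl.
    by rewrite ugt //; exact: poly_perim P.
  - by move=> i iN; rewrite (polyxx P) // uN.
  - by move=> i k j ik kj jN; apply: (poly_triangle P); rewrite ?u_le ?uN.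
  - by move=> i j k l ij jk kl lN; apply: (poly_comparison P); rewrite ?u_lt ?uN.
have v0 : v 0%N = 0%N by [].
have vN : v N.+1 = N by rewrite /v ltnNge eN.
have vS i : i != e -> v i.+1 = (v i).+1.
  move=> ne; rewrite /v; case: (ltngtP i e) ne => // ie _.
  by rewrite /= prednK // (leq_ltn_trans _ ie).
have v_le i j : (i < j)%N -> (i != e) || (j != e.+1) -> (v i < v j)%N.
  move=> ij ne; have {}ne : i <> e \/ j <> e.+1 by case/orP: ne => /eqP; [left|right].
  by rewrite /v; case: (leqP i e) => ?; case: (leqP j e) => ?; lia.
have vleN i : (i <= N.+1)%N -> (v i <= N)%N by rewrite /v; case: (leqP i e); lia.
exists (g \o v); split.
- move=> i iN /=; case: (eqVneq i e) => [->|ne].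
    by rewrite {2}/v ltnn /= /v leqnn pdistxx we.
  by rewrite vS // g1; [rewrite -vS // wuv ?ne|rewrite -vS // vleN].
- rewrite /= v0 vN g2; have := wuv 0%N N.+1 isT (leqnn _); rewrite v0 vN; apply.
  by rewrite neq_ltn e0.
- move=> i j ij jN /=; case: (boolP ((i != e) || (j != e.+1))) => [ne|].
    by rewrite -(wuv i j) // g3 ?v_le ?vleN.
  by rewrite negb_or !negbK => /andP[/eqP-> /eqP->]; rewrite we pdist_ge0.
Qed.

End Polygon.

Section Unfold.
Variables (R : realType) (G : plane_geometry R).
Notation d := (@pdist R G).
Notation q := (vers G).
Notation S := (sine G).
Notation H := (hlen G).

(** The closing side runs through the apex, so it is as long as the two sides that it replaces and
    the perimeter remains [L]. *)
Lemma cone_polygon M r phi s x L : cone_chain G M r phi s x L ->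
  r 0%N = x 0%N -> r M = L - x M -> pi <= phi M - phi 0%N ->
  polygon G M (fun i j => coned G (r i) (r j) (phi j - phi i)) (fun i => x i - x 0%N).
Proof.
move=> C r0 rM h; split.
- by rewrite subrr.
- by move=> i iM; rewrite (coned_side C iM) (cone_pos C iM) addrAC.
- rewrite /= /coned [_ < pi]ltNge h /= r0 rM.
  by have := cone_perim C; clear; lra.
- by move=> i iM; rewrite conedxx.
- by move=> i k j ik kj jM; apply: (coned_triangles C).
- by move=> i j k l ij jk kl lM; apply: (cone_comparison C).
Qed.

(* The apex goes on the side joining the two ends of the chain: straightening
   the reflex angle at the apex does not decrease its distances. *)
Lemma insert_apex M r phi s x L (a b p z : G) i :
  cone_chain G M r phi s x L -> (i <= M)%N -> 0 < r 0%N ->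
  pi <= phi M - phi 0%N ->
  d p a = r 0%N -> d p b = r M ->
  S (r 0%N + r M) * q (d p z) = S (r M) * q (d a z) + S (r 0%N) * q (d b z)
    - (S (r M) * q (r 0%N) + S (r 0%N) * q (r M)) ->
  coned G (r 0%N) (r i) (phi i - phi 0%N) <= d a z ->
  coned G (r i) (r M) (phi M - phi i) <= d b z ->
  r i <= d p z.
Proof.
move=> C iM r0 h pa pb st az bz.
have [hi|hi] := ltP (phi i - phi 0%N) pi; last first.
  move: az; rewrite /coned ltNge hi /=; have := pdist_triangle p a z.
  by rewrite [d a p]pdistC pa; clear; lra.
have [hj|hj] := ltP (phi M - phi i) pi; last first.
  move: bz; rewrite /coned ltNge hj /=; have := pdist_triangle p b z.
  by rewrite [d b p]pdistC pb; clear; lra.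
have [p0 pi' pM] : [/\ 0 <= r 0%N, 0 <= r i & 0 <= r M].
  by split; apply: (cone_ge0 C).
have [h0 hi' hM] : [/\ r 0%N < H, r i < H & r M < H] by split; apply: (cone_lt C).
have s0 := ltW (sine_gt0 r0 h0); have si := sine_ge0 pi' hi'; have sM := sine_ge0 pM hM.
have lH : r 0%N + r M < H.
  have := cone_pi_le C (leq0n M) (leqnn M) h; have := cone_le C (leq0n M).
  by have := cone_leC C (leqnn M); have := cone_perim C; clear; lra.
have sS : 0 < S (r 0%N + r M) by apply: sine_gt0 => //; move: r0 pM; clear; lra.
rewrite -(vers_le_pdist _ _ pi' (ltW hi')) -(ler_pM2l sS) st.
have ea : chord G (r 0%N) (r i) (phi i - phi 0%N) <= q (d a z).
  rewrite -(vers_polard p0 (ltW h0) pi' (ltW hi')) vers_pdist.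
  by move: az; rewrite /coned hi.
have eb : chord G (r i) (r M) (phi M - phi i) <= q (d b z).
  rewrite -(vers_polard pi' (ltW hi') pM (ltW hM)) vers_pdist.
  by move: bz; rewrite /coned hj.
have cc : cos (phi i - phi 0%N) + cos (phi M - phi i) <= 0.
  have m0 : phi i <= phi M by apply: (cone_mono C).
  have := @le_cos R (pi - (phi M - phi i)) (phi i - phi 0%N).
  rewrite [cos (pi - _)]cosB cospi sinpi mul0r addr0 mulN1r => hc.
  suff : cos (phi i - phi 0%N) <= - cos (phi M - phi i) by clear; lra.
  by apply: hc; move: hi hj h m0; clear; lra.
have := ler_wpM2l sM ea; have := ler_wpM2l s0 eb; rewrite !chordE sineD.
have := mulr_ge0_le0 (mulr_ge0 (mulr_ge0 s0 si) sM) cc.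
by clear; lra.
Qed.

Theorem polygon_unfolds N w x : polygon G N w x -> unfolds G N w.
Proof.
elim: N w x => [|M IH] w x P.
  exists (fun=> polar G 0 0); split=> //; first by rewrite pdistxx (polyxx P).
  by move=> i j ij; rewrite leqn0 => /eqP j0; move: ij; rewrite j0.
have [[e e0 [eM we]]|nz] :=
    pselect (exists2 e, (0 < e)%N & (e <= M)%N /\ w e e.+1 = 0).
  exact: (delete_vertex P e0 eM we IH).
(* Vertex 0 is the apex, and the chain index [i] stands for vertex [i.+1]. *)
pose L := x M.+1 + w 0%N M.+1.
pose o i := w 0%N i.+1; pose v i j := w i.+1 j.+1; pose y i := x i.+1.
pose s i := w i.+1 i.+2.
have OD : obstacle_data G M o s y L.
  split.
  - exact: poly_perim P.
  - by move=> i iM; apply: (poly_ge0 P).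
  - by move=> i iM; have := @poly_le_pos _ _ _ _ _ 0%N i.+1 P isT iM; rewrite (poly_pos0 P) subr0.
  - move=> i iM; have [_ + _] := poly_triangle P (i := 0%N) (k := i.+1) (j := M.+1) isT iM (leqnn _).
    by have := poly_le_pos P (i := i.+1) (j := M.+1) iM (leqnn _); rewrite /o /y /L; clear; lra.
  - by rewrite /o /y (poly_posS P) // (poly_pos0 P) add0r.
  - by rewrite /o /L addrAC subrr add0r.
  - by move=> i iM; rewrite /y (poly_posS P).
  - move=> i iM; rewrite lt_neqAle (poly_ge0 P) // andbT eq_sym; apply/eqP => si.
    by apply: nz; exists i.+1.
  - move=> i iM; by have [] := poly_triangle P (i := 0%N) (k := i.+1) (j := i.+2) isT (leqnSn _) iM.
have [r [phi [C r0 rM ro [conv str]]]] := fan_exists OD.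
have lower i j : (i < j)%N -> (j <= M)%N -> v i j <= coned G (r i) (r j) (phi j - phi i).
  apply: (fan_lower_bound C conv ro str) => //.
  - by move=> {}i k {}j ik kj jM; have [] := poly_triangle P (i := i.+1) (k := k.+1) (j := j.+1) ik kj jM.
  - move=> {}i {}j ij jM.
    by have [_ _] := poly_triangle P (i := 0%N) (k := i.+1) (j := j.+1) (leq0n _) ij jM.
  - move=> {}i k {}j ik kj jM.
    have [p [a [c [b [h1 h2 h3 h4 h5]]]]] := @poly_comparison _ _ _ _ _ P 0%N i.+1 k.+1 j.+1 isT ik kj jM.
    by exists p, a, c, b.
have rH i : (i <= M)%N -> r i <= H by move=> iM; exact: ltW (cone_lt C iM).
have [h|h] := lerP (phi M - phi 0%N) pi.
  have hij i j : (i <= j)%N -> (j <= M)%N -> phi j - phi i <= pi.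
    move=> ij jM; have := cone_mono C (leq0n i) (leq_trans ij jM).
    by have := cone_mono C jM (leqnn M); move: h; clear; lra.
  have flat i j : (i <= j)%N -> (j <= M)%N ->
      d (polar G (r i) (phi i)) (polar G (r j) (phi j)) =
      coned G (r i) (r j) (phi j - phi i).
    move=> ij jM; have iM := leq_trans ij jM.
    by rewrite pdist_polar ?(cone_ge0 C) ?rH // (coned_polard C ij jM) // hij.
  have apex i : (i <= M)%N -> d (polar G 0 0) (polar G (r i) (phi i)) = r i.
    by move=> iM; rewrite polar0 ?(cone_ge0 C) ?rH.
  exists (fun i => if i is j.+1 then polar G (r j) (phi j) else polar G 0 0); split.
  - case=> [|i] iM; first by rewrite apex // r0.
    by rewrite flat // (coned_side C).
  - by rewrite apex // rM.
  - case=> [|i] [|j] // ij jM; first by rewrite apex // ro.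
    by rewrite flat ?lower // ltnW.
have [||g [g1 g2 g3]] := IH _ _ (cone_polygon C _ _ (ltW h)).
- by rewrite r0 (obs_first OD).
- by rewrite rM (obs_last OD).
have g2' : d (g 0%N) (g M) = r 0%N + r M.
  by rewrite g2 /coned ltNge (ltW h).
have cdxx i : (i <= M)%N -> coned G (r i) (r i) (phi i - phi i) = d (g i) (g i).
  by move=> iM; rewrite conedxx pdistxx.
have low i j : (i <= j)%N -> (j <= M)%N ->
    coned G (r i) (r j) (phi j - phi i) <= d (g i) (g j).
  by rewrite leq_eqVlt => /orP[/eqP-> jM|]; [rewrite cdxx|exact: g3].
have side i : (i < M)%N -> d (g i) (g i.+1) = w i.+1 i.+2.
  by move=> iM; rewrite g1 // (coned_side C).
suff [p [p0 pM pi]] : exists p, [/\ d p (g 0%N) = r 0%N, d p (g M) = r M &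
    forall i, (i <= M)%N -> r i <= d p (g i)].
  exists (fun i => if i is j.+1 then g j else p); split.
  - by case=> [|i] iM; [rewrite p0 r0|rewrite side].
  - by rewrite pM rM.
  - case=> [|i] [|j] // ij jM; first by apply: le_trans (pi _ jM); exact: ro.
    by apply: le_trans (lower i j ij jM) _; exact: g3.
(* [between] wants a positive first part; if it is zero, the apex is put on the first vertex of the
   chain. *)
have [r00|rn0] := eqVneq (r 0%N) 0.
  exists (g 0%N); split; [by rewrite pdistxx|by rewrite g2' r00 add0r|].
  move=> i iM; apply: le_trans (low 0%N i (leq0n _) iM).
  have := le_add_coned' (phi i - phi 0%N) (cone_ge0 C (leq0n M)) (rH _ (leq0n M))
    (cone_ge0 C iM) (rH _ iM).
  by rewrite r00 add0r.
have rp : 0 < r 0%N by rewrite lt0r rn0 (cone_ge0 C).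
have lH : r 0%N + r M < H.
  have := cone_pi_le C (leq0n M) (leqnn M) (ltW h); have := cone_le C (leq0n M).
  by have := cone_leC C (leqnn M); have := cone_perim C; clear; lra.
have [p [pa pb] st] := between rp (cone_ge0 C (leqnn M)) lH g2'.
exists p; split=> // i iM; apply: (insert_apex C iM rp (ltW h) pa pb (st _)).
  exact: low.
by rewrite pdistC low.
Qed.

End Unfold.

(** * The three model planes *)

Section DotProduct.
Variables (R : realType) (n : nat).
Implicit Types u v w : 'rV[R]_n.

Lemma dotC u v : dot u v = dot v u.
Proof. by apply: eq_bigr => i _; rewrite mulrC. Qed.

Lemma dotDl u v w : dot (u + v) w = dot u w + dot v w.
Proof. by rewrite -big_split; apply: eq_bigr => i _; rewrite mxE mulrDl. Qed.

Lemma dotZl (t : R) u v : dot (t *: u) v = t * dot u v.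
Proof. by rewrite mulr_sumr; apply: eq_bigr => i _; rewrite mxE mulrA. Qed.

Lemma dotNl u v : dot (- u) v = - dot u v.
Proof. by rewrite -scaleN1r dotZl mulN1r. Qed.

Lemma dotDr u v w : dot w (u + v) = dot w u + dot w v.
Proof. by rewrite dotC dotDl !(dotC w). Qed.

Lemma dotZr (t : R) u v : dot v (t *: u) = t * dot v u.
Proof. by rewrite dotC dotZl dotC. Qed.

Lemma dotNr u v : dot v (- u) = - dot v u.
Proof. by rewrite dotC dotNl dotC. Qed.

Lemma dot_ge0 u : 0 <= dot u u.
Proof. by apply: sumr_ge0 => i _; rewrite -expr2 sqr_ge0. Qed.

Lemma dot_eq0 u v : dot u u = 0 -> dot u v = 0.
Proof.
move=> /eqP; rewrite psumr_eq0 => [/allP u0|i _]; last by rewrite -expr2 sqr_ge0.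
apply: big1 => i _; have /eqP/eqP := u0 i (mem_index_enum _).
by rewrite mulf_eq0 orbb => /eqP->; rewrite mul0r.
Qed.

Lemma dot_CauchySchwarz u v : dot u v ^+ 2 <= dot u u * dot v v.
Proof.
have [v0|v0] := eqVneq (dot v v) 0; first by rewrite dotC (dot_eq0 _ v0) v0 mulr0 expr0n.
have vp : 0 < dot v v by rewrite lt0r v0 dot_ge0.
have := dot_ge0 (dot v v *: u - dot u v *: v).
rewrite !(dotDl, dotNl, dotZl, dotDr, dotNr, dotZr) (dotC v u) => h.
by rewrite -subr_ge0 -(pmulr_rge0 _ vp); move: h; clear; lra.
Qed.

End DotProduct.

Section Coordinates.
Variable R : realType.
Implicit Types u v w : 'rV[R]_3.

Definition crd u (i : nat) : R := u 0 (inord i).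

Definition vec3 (a b c : R) : 'rV[R]_3 := \row_j [:: a; b; c]`_j.

Lemma crd_vec3 a b c :
  (crd (vec3 a b c) 0 = a) * (crd (vec3 a b c) 1 = b) * (crd (vec3 a b c) 2 = c).
Proof. by rewrite /crd !mxE !inordK. Qed.

Lemma crdD u v i : crd (u + v) i = crd u i + crd v i.
Proof. by rewrite /crd mxE. Qed.

Lemma crdZ (a : R) u i : crd (a *: u) i = a * crd u i.
Proof. by rewrite /crd mxE. Qed.

Lemma dot3E u v : dot u v = crd u 0 * crd v 0 + crd u 1 * crd v 1 + crd u 2 * crd v 2.
Proof.
rewrite /dot !big_ord_recl big_ord0 addr0 addrA /crd.
by congr (_ * _ + _ * _ + _ * _); congr (_ 0 _); apply/val_inj; rewrite /= inordK.
Qed.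

Lemma lorentz3E u v :
  lorentz u v = - (crd u 0 * crd v 0) + (crd u 1 * crd v 1 + crd u 2 * crd v 2).
Proof.
rewrite /lorentz !big_ord_recl big_ord0 addr0 /crd.
by congr (- (_ * _) + (_ * _ + _ * _)); congr (_ 0 _); apply/val_inj; rewrite /= inordK.
Qed.

End Coordinates.

(** * Spherical geometry *)

Section Sphere.
Variable R : realType.
Implicit Types (u v w : 'rV[R]_3) (a b c o p z : sphere2 R).

Definition sdot a b : R := dot (sval a) (sval b).

Lemma sdotxx a : sdot a a = 1.
Proof. by case: a => u h; apply/eqP. Qed.

Lemma sdotC a b : sdot a b = sdot b a.
Proof. exact: dotC. Qed.

Lemma sdot_itv a b : -1 <= sdot a b <= 1.
Proof.
have := sdotxx a; have := sdotxx b; rewrite /sdot => hb ha.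
have e (t : R) : dot (sval a + t *: sval b) (sval a + t *: sval b) =
    dot (sval a) (sval a) + t ^+ 2 * dot (sval b) (sval b) + 2 * t * dot (sval a) (sval b).
  by rewrite !dot3E !crdD !crdZ; ring.
have := dot_ge0 (sval a + 1 *: sval b); have := dot_ge0 (sval a + (-1) *: sval b).
by rewrite !e ha hb; lra.
Qed.

Definition sphere_dist a b : R := acos (sdot a b).

Lemma cos_sphere_dist a b : cos (sphere_dist a b) = sdot a b.
Proof. by rewrite acosK // in_itv /= sdot_itv. Qed.

Lemma sphere_dist_itv a b : 0 <= sphere_dist a b <= pi.
Proof. by rewrite acos_ge0 ?acos_lepi ?sdot_itv. Qed.

Lemma sphere_dist_le a b (x : R) : 0 <= x -> x <= pi ->
  (sphere_dist a b <= x) = (cos x <= sdot a b).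
Proof.
move=> x0 xpi; rewrite -cos_sphere_dist leNgt [RHS]leNgt ltr_cos //; rewrite in_itv /= ?x0 //.
exact: sphere_dist_itv.
Qed.

(** The Gram determinant of three vectors is the square of their determinant. *)
Lemma sdot_gram a b c :
  (sdot a c - sdot a b * sdot b c) ^+ 2 <= (1 - sdot a b ^+ 2) * (1 - sdot b c ^+ 2).
Proof.
have := sdotxx a; have := sdotxx b; have := sdotxx c; rewrite /sdot !dot3E.
move: (sval a) (sval b) (sval c) => u v w.
move: (crd u 0) (crd u 1) (crd u 2) (crd v 0) (crd v 1) (crd v 2) (crd w 0) (crd w 1) (crd w 2).
move=> u0 u1 u2 v0 v1 v2 w0 w1 w2 hw hv hu.
have : (u0 * u0 + u1 * u1 + u2 * u2) * (v0 * v0 + v1 * v1 + v2 * v2) *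
    (w0 * w0 + w1 * w1 + w2 * w2)
  + 2 * (u0 * v0 + u1 * v1 + u2 * v2) * (v0 * w0 + v1 * w1 + v2 * w2) *
    (u0 * w0 + u1 * w1 + u2 * w2)
  - (u0 * u0 + u1 * u1 + u2 * u2) * (v0 * w0 + v1 * w1 + v2 * w2) ^+ 2
  - (v0 * v0 + v1 * v1 + v2 * v2) * (u0 * w0 + u1 * w1 + u2 * w2) ^+ 2
  - (w0 * w0 + w1 * w1 + w2 * w2) * (u0 * v0 + u1 * v1 + u2 * v2) ^+ 2
  = (u0 * (v1 * w2 - v2 * w1) - u1 * (v0 * w2 - v2 * w0) + u2 * (v0 * w1 - v1 * w0)) ^+ 2.
  by ring.
rewrite hu hv hw => e.
have := sqr_ge0 (u0 * (v1 * w2 - v2 * w1) - u1 * (v0 * w2 - v2 * w0) + u2 * (v0 * w1 - v1 * w0)).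
by rewrite -e; clear; lra.
Qed.

Lemma sphere_triangle b a c : sphere_dist a c <= sphere_dist a b + sphere_dist b c.
Proof.
have /andP[x0 xpi] := sphere_dist_itv a b; have /andP[y0 ypi] := sphere_dist_itv b c.
have [h|h] := leP (sphere_dist a b + sphere_dist b c) pi; last first.
  by apply: le_trans (ltW h); have /andP[] := sphere_dist_itv a c.
rewrite sphere_dist_le ?addr_ge0 // cosD !cos_sphere_dist.
have g := sdot_gram a b c.
have s0 : 0 <= sin (sphere_dist a b) * sin (sphere_dist b c).
  by rewrite mulr_ge0 // sin_ge0_pi ?x0 ?y0.
rewrite -!cos_sphere_dist -!sin2cos2 -exprMn !cos_sphere_dist in g.
rewrite lerBlDr -lerBlDl -[X in X <= _]opprK lerNl opprB in |- *.
have := g; rewrite -ler_sqrt ?sqr_ge0 // !sqrtr_sqr (ger0_norm s0) ler_norml.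
by clear; lra.
Qed.

Lemma sphere_polar_subproof (r phi : R) :
  dot (vec3 (cos r) (sin r * cos phi) (sin r * sin phi))
    (vec3 (cos r) (sin r * cos phi) (sin r * sin phi)) == 1.
Proof.
apply/eqP; rewrite dot3E !crd_vec3.
transitivity (cos r ^+ 2 + sin r ^+ 2 * (cos phi ^+ 2 + sin phi ^+ 2)); first by ring.
by rewrite cos2Dsin2 mulr1 cos2Dsin2.
Qed.

Definition sphere_polar (r phi : R) : sphere2 R :=
  exist _ (vec3 (cos r) (sin r * cos phi) (sin r * sin phi)) (sphere_polar_subproof r phi).

Lemma sdot_polar r r' phi psi : sdot (sphere_polar r phi) (sphere_polar r' psi) =
  cos r * cos r' + sin r * sin r' * cos (phi - psi).
Proof. by rewrite /sdot dot3E !crd_vec3 cosB; ring. Qed.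

(** Expand [dot w w >= 0] for [w] the combination that vanishes in the comparison figure. All
    hypotheses on sides and diagonal lower it, so the remaining term, of weight [la * lb], must be
    favourable. *)
Lemma sphere_tensegrity o a c b (qoa qoc qob qac qcb qab lo la lc lb m : R) :
  0 <= lo -> 0 <= la -> 0 <= lc -> 0 <= lb -> 0 < la + lb ->
  lo + lc - la - lb = m ->
  lc * qoc - la * qoa - lb * qob = m ->
  lo * qoc - la * qac - lb * qcb = m ->
  lo * qoa + lc * qac - lb * qab = m ->
  lo * qob + lc * qcb - la * qab = m ->
  1 - sdot o a <= qoa -> 1 - sdot o b <= qob ->
  1 - sdot a c <= qac -> 1 - sdot c b <= qcb -> qoc <= 1 - sdot o c ->
  1 - sdot a b <= qab.
Proof.
move=> lo0 la0 lc0 lb0 lab e0 e1 e2 e3 e4 hoa hob hac hcb hoc.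
pose w := lo *: sval o + lc *: sval c + (- la) *: sval a + (- lb) *: sval b.
have wl v : dot w v = lo * dot (sval o) v + lc * dot (sval c) v
    - la * dot (sval a) v - lb * dot (sval b) v by rewrite /w !dotDl !dotZl; ring.
have wz z : dot w (sval z) = lo * sdot o z + lc * sdot c z - la * sdot a z - lb * sdot b z.
  exact: wl.
have wE : dot w w = lo * dot w (sval o) + lc * dot w (sval c) - la * dot w (sval a) - lb * dot w (sval b).
  by rewrite (wl w) !(dotC (sval _) w).
have w2 : dot w w + 2 * (la * lb * (1 - sdot a b - qab)) <= 0.
  have m2 : m ^+ 2 = 2 * (lo * lc * qoc - lo * la * qoa - lo * lb * qob - lc * la * qac
      - lc * lb * qcb + la * lb * qab).
    transitivity (m * (lo + lc - la - lb)); first by rewrite e0.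
    transitivity (lo * m + lc * m - la * m - lb * m); first by ring.
    by rewrite -{1}e1 -{1}e2 -{1}e3 -e4; ring.
  have -> : dot w w = m ^+ 2 - 2 * (lo * lc * (1 - sdot o c) - lo * la * (1 - sdot o a)
      - lo * lb * (1 - sdot o b) - lc * la * (1 - sdot a c) - lc * lb * (1 - sdot c b)
      + la * lb * (1 - sdot a b)).
    rewrite wE !wz !sdotxx -e0 (sdotC c o) (sdotC a o) (sdotC b o) (sdotC b c) (sdotC b a) (sdotC c a).
    by ring.
  have := ler_wpM2l (mulr_ge0 lo0 lc0) hoc; have := ler_wpM2l (mulr_ge0 lo0 la0) hoa.
  have := ler_wpM2l (mulr_ge0 lo0 lb0) hob; have := ler_wpM2l (mulr_ge0 lc0 la0) hac.
  have := ler_wpM2l (mulr_ge0 lc0 lb0) hcb; move: m2; clear; lra.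
have w0 := dot_ge0 w.
(* Without that term the inequality forces [w = 0]; pairing [w] with [b] or [a] then gives the
   claim. *)
have wn z : la * lb = 0 -> dot w (sval z) = 0.
  move=> l0; have : dot w w = 0.
    by apply/eqP; rewrite eq_le w0 andbT; move: w2; rewrite l0; clear; lra.
  rewrite dot3E => /eqP; rewrite -!expr2 !paddr_eq0 ?addr_ge0 ?sqr_ge0 // !sqrf_eq0.
  by rewrite dot3E => /andP[/andP[/eqP-> /eqP->] /eqP->]; rewrite !mul0r !addr0.
have [lb1|lb1] := eqVneq lb 0.
  have la1 : 0 < la by move: lab; rewrite lb1 addr0.
  rewrite -(ler_pM2l la1); have := wn b; rewrite lb1 mulr0 wz => /(_ erefl).
  have := ler_wpM2l lo0 hob; have := ler_wpM2l lc0 hcb.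
  by move: e0 e4; rewrite lb1; clear; lra.
have [la1|la1] := eqVneq la 0.
  have lb2 : 0 < lb by move: lab; rewrite la1 add0r.
  rewrite -(ler_pM2l lb2); have := wn a; rewrite la1 mul0r wz => /(_ erefl).
  have := ler_wpM2l lo0 hoa; have := ler_wpM2l lc0 hac.
  by move: e0 e3; rewrite la1 (sdotC b a) (sdotC c a); clear; lra.
have ll : 0 < la * lb by rewrite mulr_gt0 // lt0r ?la1 ?lb1.
by rewrite -subr_le0 -(pmulr_rle0 _ ll); move: w2 w0; clear; lra.
Qed.

(** The point is a linear combination of [a] and [b]; linearity of the inner product with [z] is
    Stewart's theorem. *)
Lemma sphere_between a b (x y : R) : 0 < x -> 0 <= y -> x + y < pi ->
  sphere_dist a b = x + y ->
  exists2 p, sphere_dist p a = x /\ sphere_dist p b = y &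
    forall z, sin (x + y) * (1 - sdot p z) =
      sin y * (1 - sdot a z) + sin x * (1 - sdot b z)
      - (sin y * (1 - cos x) + sin x * (1 - cos y)).
Proof.
move=> x0 y0 xy dab.
have s0 : 0 < sin (x + y) by apply: sin_gt0_pi; rewrite xy andbT ltr_wpDr.
have sab : sdot a b = cos (x + y) by rewrite -dab cos_sphere_dist.
pose s := sin (x + y).
pose w := (sin y / s) *: sval a + (sin x / s) *: sval b.
have sn : s != 0 by rewrite gt_eqF.
have wz z : dot w (sval z) = (sin y * sdot a z + sin x * sdot b z) / s.
  by rewrite /w !dotDl !dotZl /sdot; field.
have wa : dot w (sval a) = cos x.
  rewrite wz sdotxx (sdotC b a) sab; apply: (mulIf sn); rewrite divfK //.
  rewrite /s cosD sinD; apply: subr0_eq.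
  transitivity (sin y * (1 - (cos x ^+ 2 + sin x ^+ 2))); first by ring.
  by rewrite cos2Dsin2 subrr mulr0.
have wb : dot w (sval b) = cos y.
  rewrite wz sdotxx sab; apply: (mulIf sn); rewrite divfK //.
  rewrite /s cosD sinD; apply: subr0_eq.
  transitivity (sin x * (1 - (cos y ^+ 2 + sin y ^+ 2))); first by ring.
  by rewrite cos2Dsin2 subrr mulr0.
have w1 : dot w w == 1.
  have -> : dot w w = sin y / s * dot w (sval a) + sin x / s * dot w (sval b).
    by rewrite {1}/w dotDl !dotZl !(dotC (sval _) w).
  rewrite wa wb; apply/eqP/(mulIf sn).
  rewrite mul1r; transitivity (sin y * cos x + sin x * cos y); first by field.
  by rewrite /s sinD; ring.
exists (exist _ w w1); last first.
  move=> z; rewrite {1}/sdot /= wz -/s mulrBr mulr1 mulrCA divff // mulr1.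
  by rewrite /s sinD; ring.
rewrite /sphere_dist /sdot /= wa wb; split; rewrite cosK // in_itv /=.
  by rewrite (ltW x0) ltW // (le_lt_trans _ xy) // lerDl.
by rewrite y0 ltW // (lt_trans _ xy) // ltrDr.
Qed.

(** [y] may exceed pi: the difference of cosines is a product of sines of the half sum and the half
    difference, both strictly between 0 and pi. *)
Lemma vers_sphere_lt (x y : R) : 0 <= x -> x < y -> x + y < 2 * pi ->
  1 - cos x < 1 - cos y.
Proof.
move=> x0 xy xypi; rewrite ltrD2l ltrN2.
pose A := (x + y) / 2; pose B := (y - x) / 2.
have -> : cos x = cos (A - B) by congr cos; rewrite /A /B; field.
have -> : cos y = cos (A + B) by congr cos; rewrite /A /B; field.
have sA : 0 < sin A by apply: sin_gt0_pi; rewrite /A; move: x0 xy xypi; clear; lra.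
have sB : 0 < sin B by apply: sin_gt0_pi; rewrite /B; move: x0 xy xypi; clear; lra.
by rewrite cosB cosD; have := mulr_gt0 sA sB; clear; lra.
Qed.

Definition spherical_geometry : plane_geometry R.
Proof.
refine (@PlaneGeometry R (sphere2 R) sphere_dist 1 (fun x => 1 - cos x) sin pi sphere_polar
  _ _ _ _ _ _ _ _ _ _ _ _ _ _ _ _ _).
- by rewrite cos0 subrr.
- by move=> x; rewrite cosN.
- exact: sinN.
- by move=> x y; rewrite cosD; ring.
- by move=> x y; rewrite sinD; ring.
- by move=> x; rewrite sin2cos2; ring.
- exact: vers_sphere_lt.
- by move=> x; apply: cvgB; [exact: cvg_cst|exact: continuous_cos].
- by move=> x x0 xpi; apply: sin_gt0_pi; rewrite x0.
- by move=> a b; rewrite /sphere_dist sdotC.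
- by move=> a; rewrite /sphere_dist sdotxx acos1.
- exact: sphere_triangle.
- move=> a b c e; have /andP[h0 hpi] := sphere_dist_itv c e.
  by rewrite lerD2l lerN2 [RHS]sphere_dist_le // !cos_sphere_dist.
- move=> r phi psi r0 rpi; rewrite /sphere_dist sdot_polar cos0 sin0 !mul0r addr0 mul1r.
  by rewrite cosK // in_itv /= r0.
- move=> r r' phi psi _ _ _ _; rewrite cos_sphere_dist sdot_polar [cos (r - r')]cosB; ring.
- move=> o a c b qoa qoc qob qac qcb qab lo la lc lb m lo0 la0 lc0 lb0 lab _ _ _.
  rewrite mul1r !cos_sphere_dist; exact: sphere_tensegrity.
- move=> a b x y x0 y0 xy dab; have [p pab pz] := sphere_between x0 y0 xy dab.
  by exists p => // z; rewrite !cos_sphere_dist pz.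
Defined.

End Sphere.

(** * Euclidean geometry *)

Section Plane.
Variable R : realType.
Implicit Types a b c o p z : 'rV[R]_2.

Definition sqdist a b : R := dot (a - b) (a - b).

Definition plane_dist a b : R := Num.sqrt (sqdist a b).

Lemma sqdist_ge0 a b : 0 <= sqdist a b.
Proof. exact: dot_ge0. Qed.

Lemma plane_dist_sqr a b : plane_dist a b ^+ 2 = sqdist a b.
Proof. by rewrite sqr_sqrtr ?sqdist_ge0. Qed.

Lemma plane_dist_ge0 a b : 0 <= plane_dist a b.
Proof. exact: sqrtr_ge0. Qed.

Lemma sqdistE a b : sqdist a b = dot a a + dot b b - 2 * dot a b.
Proof.
by rewrite /sqdist !(dotDl, dotNl, dotDr, dotNr) (dotC b a); ring.
Qed.

Lemma sqdistC a b : sqdist a b = sqdist b a.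
Proof. by rewrite !sqdistE (dotC b a); ring. Qed.

Lemma sqdistxx a : sqdist a a = 0.
Proof. by rewrite sqdistE; ring. Qed.

Lemma plane_triangle b a c : plane_dist a c <= plane_dist a b + plane_dist b c.
Proof.
rewrite -ler_sqr ?nnegrE ?addr_ge0 ?plane_dist_ge0 // sqrrD !plane_dist_sqr.
have -> : sqdist a c = sqdist a b + sqdist b c + 2 * dot (a - b) (b - c).
  by rewrite !sqdistE !(dotDl, dotNl, dotDr, dotNr); ring.
suff : dot (a - b) (b - c) <= plane_dist a b * plane_dist b c by clear; lra.
apply: le_trans (ler_norm _) _.
rewrite -ler_sqr ?nnegrE ?mulr_ge0 ?plane_dist_ge0 // real_normK ?num_real //.
by rewrite exprMn !plane_dist_sqr dot_CauchySchwarz.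
Qed.

Definition plane_polar (r phi : R) : 'rV[R]_2 := \row_j [:: r * cos phi; r * sin phi]`_j.

Lemma dot_polar r r' phi psi :
  dot (plane_polar r phi) (plane_polar r' psi) = r * r' * cos (phi - psi).
Proof.
rewrite /dot !big_ord_recl big_ord0 !mxE /= cosB; ring.
Qed.

Lemma sqdist_polar r r' phi psi :
  sqdist (plane_polar r phi) (plane_polar r' psi) =
  r ^+ 2 + r' ^+ 2 - 2 * (r * r' * cos (phi - psi)).
Proof. by rewrite sqdistE !dot_polar !subrr cos0; ring. Qed.

(** As on the sphere, but the weights now add up to zero, so [dot w w] depends on distances alone
    and [dot w z] is [K - F z]. *)
Lemma plane_tensegrity o a c b (qoa qoc qob qac qcb qab lo la lc lb m : R) :
  0 <= lo -> 0 <= la -> 0 <= lc -> 0 <= lb -> 0 < la + lb ->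
  lo + lc - la - lb = 0 ->
  lc * qoc - la * qoa - lb * qob = m ->
  lo * qoc - la * qac - lb * qcb = m ->
  lo * qoa + lc * qac - lb * qab = m ->
  lo * qob + lc * qcb - la * qab = m ->
  sqdist o a / 2 <= qoa -> sqdist o b / 2 <= qob ->
  sqdist a c / 2 <= qac -> sqdist c b / 2 <= qcb -> qoc <= sqdist o c / 2 ->
  sqdist a b / 2 <= qab.
Proof.
move=> lo0 la0 lc0 lb0 lab e0 e1 e2 e3 e4 hoa hob hac hcb hoc.
pose Q u v := sqdist u v / 2; pose w := lo *: o + lc *: c - la *: a - lb *: b.
pose F z := lo * Q o z + lc * Q c z - la * Q a z - lb * Q b z.
pose K := (lo * dot o o + lc * dot c c - la * dot a a - lb * dot b b) / 2.
have wz z : dot w z = K - F z.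
  apply/esym/subr0_eq; transitivity ((lo + lc - la - lb) * (- (dot z z / 2))).
    by rewrite /K /F /Q !sqdistE /w !(dotDl, dotNl, dotZl); field.
  by rewrite e0 mul0r.
have Qxx z : Q z z = 0 by rewrite /Q sqdistxx mul0r.
have QC y z : Q y z = Q z y by rewrite /Q sqdistC.
have wE : dot w w = - 2 * (lo * lc * Q o c - lo * la * Q o a - lo * lb * Q o b
    - lc * la * Q a c - lc * lb * Q c b + la * lb * Q a b).
  have -> : dot w w = lo * dot w o + lc * dot w c - la * dot w a - lb * dot w b.
    by rewrite {2}/w !(dotDr, dotNr, dotZr).
  apply: subr0_eq; transitivity ((lo + lc - la - lb) * K); last by rewrite e0 mul0r.
  rewrite !wz /F !Qxx (QC c o) (QC a o) (QC b o) (QC b c) (QC b a) (QC c a); ring.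
have w2 : dot w w + 2 * (la * lb * (Q a b - qab)) <= 0.
  have m2 : 0 = 2 * (lo * lc * qoc - lo * la * qoa - lo * lb * qob - lc * la * qac
      - lc * lb * qcb + la * lb * qab).
    transitivity (m * (lo + lc - la - lb)); first by rewrite e0 mulr0.
    transitivity (lo * m + lc * m - la * m - lb * m); first by ring.
    by rewrite -{1}e1 -{1}e2 -{1}e3 -e4; ring.
  have := ler_wpM2l (mulr_ge0 lo0 lc0) hoc; have := ler_wpM2l (mulr_ge0 lo0 la0) hoa.
  have := ler_wpM2l (mulr_ge0 lo0 lb0) hob; have := ler_wpM2l (mulr_ge0 lc0 la0) hac.
  have := ler_wpM2l (mulr_ge0 lc0 lb0) hcb; rewrite wE /Q; move: m2; clear; lra.
have w0 := dot_ge0 w.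
have FK z : la * lb = 0 -> F z = K.
  move=> l0; have w00 : dot w w = 0.
    by apply/eqP; rewrite eq_le w0 andbT; move: w2; rewrite l0; clear; lra.
  by have := wz z; rewrite (dot_eq0 _ w00); clear; lra.
have [lb1|lb1] := eqVneq lb 0.
  have la1 : 0 < la by move: lab; rewrite lb1 addr0.
  have := FK b; have := FK c; rewrite lb1 mulr0 => /(_ erefl) kc /(_ erefl) kb.
  rewrite -(ler_pM2l la1); move: kc kb; rewrite /F !Qxx lb1 /Q => kc kb.
  have := ler_wpM2l lo0 hob; have := ler_wpM2l lc0 hcb.
  have := ler_wpM2l lo0 hoc; have := ler_wpM2l la0 hac.
  by move: e2 e4 kc kb; rewrite lb1; clear; lra.
have [la1|la1] := eqVneq la 0.
  have lb2 : 0 < lb by move: lab; rewrite la1 add0r.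
  have := FK a; have := FK c; rewrite la1 mul0r => /(_ erefl) kc /(_ erefl) ka.
  rewrite -(ler_pM2l lb2); move: kc ka; rewrite /F !Qxx la1 /Q.
  rewrite (sqdistC b a) (sqdistC b c) (sqdistC c a) => kc ka.
  have := ler_wpM2l lo0 hoa; have := ler_wpM2l lc0 hac.
  have := ler_wpM2l lo0 hoc; have := ler_wpM2l lb0 hcb.
  by move: e2 e3 kc ka; rewrite la1; clear; lra.
have ll : 0 < la * lb by rewrite mulr_gt0 // lt0r ?la1 ?lb1.
by rewrite -subr_le0 -(pmulr_rle0 _ ll); move: w2 w0; rewrite /Q; clear; lra.
Qed.

Lemma plane_between a b (x y : R) : 0 < x -> 0 <= y -> plane_dist a b = x + y ->
  exists2 p, plane_dist p a = x /\ plane_dist p b = y &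
    forall z, (x + y) * (sqdist p z / 2) =
      y * (sqdist a z / 2) + x * (sqdist b z / 2) - (y * (x ^+ 2 / 2) + x * (y ^+ 2 / 2)).
Proof.
move=> x0 y0 dab; have s0 : 0 < x + y by rewrite ltr_wpDr.
have sn : x + y != 0 by rewrite gt_eqF.
have sab : sqdist a b = (x + y) ^+ 2 by rewrite -dab plane_dist_sqr.
pose p := (y / (x + y)) *: a + (x / (x + y)) *: b.
have pz z : sqdist p z = (y * sqdist a z + x * sqdist b z) / (x + y) - x * y.
  have -> : x * y = x * y / (x + y) ^+ 2 * sqdist a b by rewrite sab; field.
  by rewrite !sqdistE /p !(dotDl, dotZl, dotDr, dotZr) (dotC b a); field.
exists p; last by move=> z; rewrite pz; field.
rewrite /plane_dist !pz !sqdistxx (sqdistC b a) sab; split.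
  by rewrite (_ : _ - _ = x ^+ 2); [rewrite sqrtr_sqr gtr0_norm|field].
by rewrite (_ : _ - _ = y ^+ 2); [rewrite sqrtr_sqr ger0_norm|field].
Qed.

Definition planar_geometry (H : R) : plane_geometry R.
Proof.
refine (@PlaneGeometry R 'rV[R]_2 plane_dist 0 (fun x => x ^+ 2 / 2) id H plane_polar
  _ _ _ _ _ _ _ _ _ _ _ _ _ _ _ _ _).
- by rewrite expr0n mul0r.
- by move=> x; rewrite sqrrN.
- by [].
- by move=> x y; field.
- by move=> x y /=; ring.
- by move=> x /=; field.
- move=> x y x0 xy _; rewrite ltr_pM2r // ltr_sqr ?nnegrE //.
  exact: le_trans (ltW xy).
- by move=> x; apply: cvgMl; exact: exprn_continuous.
- by [].
- by move=> a b; rewrite /plane_dist sqdistC.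
- by move=> a; rewrite /plane_dist sqdistxx sqrtr0.
- exact: plane_triangle.
- by move=> a b c e; rewrite ler_pM2r // ler_sqr ?nnegrE ?plane_dist_ge0.
- move=> r phi psi r0 _; rewrite /plane_dist sqdist_polar !mul0r mulr0 subr0 expr0n add0r.
  by rewrite sqrtr_sqr ger0_norm.
- by move=> r r' phi psi _ _ _ _; rewrite plane_dist_sqr sqdist_polar; field.
- move=> o a c b qoa qoc qob qac qcb qab lo la lc lb m lo0 la0 lc0 lb0 lab _ _ _.
  rewrite mul0r !plane_dist_sqr; exact: plane_tensegrity.
- move=> a b x y x0 y0 _ dab; have [p pab pz] := plane_between x0 y0 dab.
  by exists p => // z; rewrite !plane_dist_sqr pz.
Defined.

End Plane.

(** * Hyperbolic geometry *)

Section Hyperbolic.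
Variable R : realType.
Implicit Types (x y : R) (u v w : 'rV[R]_3) (a b c o p z : hyperboloid2 R).

Definition cosh x : R := (expR x + expR (- x)) / 2.
Definition sinh x : R := (expR x - expR (- x)) / 2.

Lemma expRNM x : expR x * expR (- x) = 1 :> R.
Proof. by rewrite -expRD subrr expR0. Qed.

Lemma coshN x : cosh (- x) = cosh x.
Proof. by rewrite /cosh opprK addrC. Qed.

Lemma sinhN x : sinh (- x) = - sinh x.
Proof. by rewrite /sinh opprK -mulNr opprB. Qed.

Lemma cosh0 : cosh 0 = 1.
Proof. by rewrite /cosh oppr0 expR0; field. Qed.

Lemma sinh0 : sinh 0 = 0.
Proof. by rewrite /sinh oppr0 subrr mul0r. Qed.

Lemma coshD x y : cosh (x + y) = cosh x * cosh y + sinh x * sinh y.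
Proof. by rewrite /cosh /sinh opprD !expRD; field. Qed.

Lemma sinhD x y : sinh (x + y) = sinh x * cosh y + cosh x * sinh y.
Proof. by rewrite /cosh /sinh opprD !expRD; field. Qed.

Lemma cosh2sinh2 x : cosh x ^+ 2 - sinh x ^+ 2 = 1.
Proof. by rewrite -(expRNM x) /cosh /sinh; field. Qed.

Lemma sinh_gt0 x : 0 < x -> 0 < sinh x.
Proof. by move=> x0; rewrite divr_gt0 // subr_gt0 ltr_expR; lra. Qed.

Lemma sinh_ge0 x : 0 <= x -> 0 <= sinh x.
Proof. by rewrite le_eqVlt => /orP[/eqP<-|/sinh_gt0/ltW//]; rewrite sinh0. Qed.

Lemma cosh_lt x y : 0 <= x -> x < y -> cosh x < cosh y.
Proof.
move=> x0 xy; pose A := (x + y) / 2; pose B := (y - x) / 2.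
have -> : cosh x = cosh (A - B) by congr cosh; rewrite /A /B; field.
have -> : cosh y = cosh (A + B) by congr cosh; rewrite /A /B; field.
rewrite !coshD coshN sinhN.
have sA : 0 < sinh A by apply: sinh_gt0; rewrite /A; lra.
have sB : 0 < sinh B by apply: sinh_gt0; rewrite /B; lra.
by have := mulr_gt0 sA sB; clear; lra.
Qed.

Lemma cosh_le x y : 0 <= x -> 0 <= y -> (cosh x <= cosh y) = (x <= y).
Proof.
move=> x0 y0; apply/idP/idP => [|].
  by rewrite !leNgt; apply: contra => /cosh_lt; apply.
by rewrite le_eqVlt => /orP[/eqP->//|xy]; exact/ltW/cosh_lt.
Qed.

Lemma cosh_inj x y : 0 <= x -> 0 <= y -> cosh x = cosh y -> x = y.
Proof. by move=> x0 y0 e; apply/eqP; rewrite eq_le -(cosh_le x0 y0) -(cosh_le y0 x0) e lexx. Qed.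

Lemma arcoshP x : 1 <= x -> 0 <= arcosh x /\ cosh (arcosh x) = x.
Proof.
move=> x1; have x2 : 0 <= x ^+ 2 - 1 by nra.
set s := Num.sqrt (x ^+ 2 - 1); have s0 : 0 <= s by exact: sqrtr_ge0.
have ss : s ^+ 2 = x ^+ 2 - 1 by rewrite sqr_sqrtr.
have xs : 1 <= x + s by lra.
have e : expR (arcosh x) = x + s by rewrite lnK // posrE (lt_le_trans _ xs).
split; first by rewrite ln_ge0.
have e' : expR (- arcosh x) = x - s.
  have n0 : x + s != 0 by rewrite gt_eqF // (lt_le_trans _ xs).
  apply: (mulfI n0); rewrite -{1}e expRNM.
  by transitivity (x ^+ 2 - s ^+ 2); [rewrite ss|]; ring.
by rewrite /cosh e e'; field.
Qed.

Definition hform u v : R := - lorentz u v.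

Lemma hformC u v : hform u v = hform v u.
Proof. by rewrite /hform !lorentz3E; ring. Qed.

Lemma hformDl u v w : hform (u + v) w = hform u w + hform v w.
Proof. by rewrite /hform !lorentz3E !crdD; ring. Qed.

Lemma hformZl (t : R) u v : hform (t *: u) v = t * hform u v.
Proof. by rewrite /hform !lorentz3E !crdZ; ring. Qed.

Lemma hformDr u v w : hform w (u + v) = hform w u + hform w v.
Proof. by rewrite hformC hformDl !(hformC w). Qed.

Lemma hformZr (t : R) u v : hform v (t *: u) = t * hform v u.
Proof. by rewrite hformC hformZl hformC. Qed.

(** The form has signature (1, 2), hence determinant 1, and the Gram determinant is again a
    square. *)
Lemma hform_gram u v w :
  0 <= hform u u * hform v v * hform w w + 2 * hform u v * hform v w * hform u w
    - hform u u * hform v w ^+ 2 - hform v v * hform u w ^+ 2 - hform w w * hform u v ^+ 2.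
Proof.
rewrite /hform !lorentz3E.
move: (crd u 0) (crd u 1) (crd u 2) (crd v 0) (crd v 1) (crd v 2) (crd w 0) (crd w 1) (crd w 2).
move=> u0 u1 u2 v0 v1 v2 w0 w1 w2.
rewrite [leRHS](_ : _ = (u0 * (v1 * w2 - v2 * w1) - u1 * (v0 * w2 - v2 * w0)
  + u2 * (v0 * w1 - v1 * w0)) ^+ 2); first exact: sqr_ge0.
by ring.
Qed.

(** The orthogonal complement of a timelike [u] is negative definite, which reverses the usual
    inequality. *)
Lemma hform_reversed_CauchySchwarz u v : 0 < hform u u -> hform u u * hform v v <= hform u v ^+ 2.
Proof.
rewrite /hform !lorentz3E.
move: (crd u 0) (crd u 1) (crd u 2) (crd v 0) (crd v 1) (crd v 2) => u0 u1 u2 v0 v1 v2 h.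
have u00 : 0 < u0 ^+ 2 by have := sqr_ge0 u1; have := sqr_ge0 u2; move: h; clear; nra.
rewrite -subr_ge0 -(pmulr_rge0 _ u00).
rewrite [leRHS](_ : _ = - (- (u0 * u0) + (u1 * u1 + u2 * u2)) *
  ((u0 * v2 - u2 * v0) ^+ 2 + (u0 * v1 - u1 * v0) ^+ 2)
  + (u1 * (u0 * v1 - u1 * v0) + u2 * (u0 * v2 - u2 * v0)) ^+ 2); last by ring.
by rewrite addr_ge0 ?sqr_ge0 // mulr_ge0 ?(ltW h) // addr_ge0 ?sqr_ge0.
Qed.

Definition hdot a b : R := hform (sval a) (sval b).

Lemma hdotC a b : hdot a b = hdot b a.
Proof. exact: hformC. Qed.

Lemma hdotxx a : hdot a a = 1.
Proof. by have /andP[/eqP h _] := svalP a; rewrite /hdot /hform h opprK. Qed.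

Lemma crd0_gt0 a : 0 < crd (sval a) 0.
Proof.
have /andP[_] := svalP a; rewrite /crd (_ : inord 0 = 0) //.
by apply/val_inj; rewrite /= inordK.
Qed.

Lemma hdot_ge1 a b : 1 <= hdot a b.
Proof.
have ha := hdotxx a; have hb := hdotxx b; have a0 := crd0_gt0 a; have b0 := crd0_gt0 b.
have h : 1 <= hdot a b ^+ 2.
  have := @hform_reversed_CauchySchwarz (sval a) (sval b); rewrite -/(hdot a a) -/(hdot b b) ha hb mulr1.
  by apply.
suff p : 0 <= hdot a b by move: h; rewrite -[X in X <= _ -> _](expr1n _ 2) ler_sqr ?nnegrE.
move: ha hb a0 b0; rewrite /hdot /hform !lorentz3E; move: (sval a) (sval b) => u v.
move: (crd u 0) (crd u 1) (crd u 2) (crd v 0) (crd v 1) (crd v 2) => u0 u1 u2 v0 v1 v2.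
clear => ha hb u00 v00.
suff : u1 * v1 + u2 * v2 <= u0 * v0 by lra.
apply: le_trans (ler_norm _) _.
rewrite -ler_sqr ?nnegrE ?mulr_ge0 ?(ltW u00) ?(ltW v00) // real_normK ?num_real //.
rewrite exprMn (_ : u0 ^+ 2 = 1 + u1 ^+ 2 + u2 ^+ 2); last by lra.
rewrite (_ : v0 ^+ 2 = 1 + v1 ^+ 2 + v2 ^+ 2); last by lra.
have := sqr_ge0 (u1 * v2 - u2 * v1); have := sqr_ge0 u1; have := sqr_ge0 u2.
by have := sqr_ge0 v1; have := sqr_ge0 v2; lra.
Qed.

Definition hyp_dist a b : R := arcosh (hdot a b).

Lemma hyp_dist_ge0 a b : 0 <= hyp_dist a b.
Proof. by have [] := arcoshP (hdot_ge1 a b). Qed.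

Lemma cosh_hyp_dist a b : cosh (hyp_dist a b) = hdot a b.
Proof. by have [] := arcoshP (hdot_ge1 a b). Qed.

Lemma hyp_triangle b a c : hyp_dist a c <= hyp_dist a b + hyp_dist b c.
Proof.
have x0 := hyp_dist_ge0 a b; have y0 := hyp_dist_ge0 b c.
rewrite -cosh_le ?addr_ge0 ?hyp_dist_ge0 // coshD.
have := hform_gram (sval a) (sval b) (sval c); rewrite -/(hdot a a) -/(hdot b b) -/(hdot c c).
rewrite -/(hdot a b) -/(hdot b c) -/(hdot a c) !hdotxx => g.
have s0 := mulr_ge0 (sinh_ge0 x0) (sinh_ge0 y0).
have s2 t : sinh t ^+ 2 = cosh t ^+ 2 - 1 by rewrite -(cosh2sinh2 t); ring.
rewrite -lerBlDl.
have h : `|cosh (hyp_dist a c) - cosh (hyp_dist a b) * cosh (hyp_dist b c)| <=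
    sinh (hyp_dist a b) * sinh (hyp_dist b c).
  rewrite -ler_sqr ?nnegrE // real_normK ?num_real // exprMn !s2 !cosh_hyp_dist.
  by move: g; clear; lra.
exact: le_trans (ler_norm _) h.
Qed.

Lemma hyp_polar_subproof (r phi : R) :
  (lorentz (vec3 (cosh r) (sinh r * cos phi) (sinh r * sin phi))
     (vec3 (cosh r) (sinh r * cos phi) (sinh r * sin phi)) == -1) &&
  (0 < vec3 (cosh r) (sinh r * cos phi) (sinh r * sin phi) 0 0).
Proof.
apply/andP; split.
  apply/eqP; rewrite lorentz3E !crd_vec3.
  transitivity (- (cosh r ^+ 2 - sinh r ^+ 2 * (cos phi ^+ 2 + sin phi ^+ 2))); first by ring.
  by rewrite cos2Dsin2 mulr1 cosh2sinh2.
by rewrite mxE /= divr_gt0 // addr_gt0 ?expR_gt0.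
Qed.

Definition hyp_polar (r phi : R) : hyperboloid2 R := 
  exist _ (vec3 (cosh r) (sinh r * cos phi) (sinh r * sin phi)) (hyp_polar_subproof r phi).

Lemma hdot_polar r r' phi psi : hdot (hyp_polar r phi) (hyp_polar r' psi) =
  cosh r * cosh r' - sinh r * sinh r' * cos (phi - psi).
Proof. by rewrite /hdot /hform lorentz3E !crd_vec3 cosB; ring. Qed.

(** The form is indefinite, so the square of the dependency has no sign. Its two halves
    [v = lo o + lc c] and [y = la a + lb b] are compared instead; in the figure they coincide, with
    square [N]. Here [v] has square at least [N] and its product with [y] is at most [N], so the
    reversed Cauchy-Schwarz inequality leaves [y] a square of at most [N]. *)
Lemma hyp_tensegrity o a c b (woa woc wob wac wcb wab lo la lc lb : R) :
  0 <= lo -> 0 <= la -> 0 <= lc -> 0 <= lb -> 0 < la + lb -> 0 < lo + lc ->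
  1 <= woc -> 1 <= wab ->
  lo + lc * woc = la * woa + lb * wob ->
  lo * woc + lc = la * wac + lb * wcb ->
  lo * woa + lc * wac = la + lb * wab ->
  lo * wob + lc * wcb = la * wab + lb ->
  hdot o a <= woa -> hdot o b <= wob -> hdot a c <= wac -> hdot c b <= wcb ->
  woc <= hdot o c ->
  hdot a b <= wab.
Proof.
move=> lo0 la0 lc0 lb0 lab loc oc1 ab1 e1 e2 e3 e4 hoa hob hac hcb hoc.
pose v := lo *: sval o + lc *: sval c.
pose N := lo ^+ 2 + lc ^+ 2 + 2 * lo * lc * woc.
have vv : hform v v = lo ^+ 2 + lc ^+ 2 + 2 * lo * lc * hdot o c.
  rewrite /v !(hformDl, hformZl, hformDr, hformZr).
  by rewrite -/(hdot o o) -/(hdot c c) -/(hdot o c) -/(hdot c o) !hdotxx (hdotC c o); ring.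
have vz z : hform v (sval z) = lo * hdot o z + lc * hdot c z.
  by rewrite /v hformDl !hformZl.
have N0 : 0 < N.
  rewrite /N; have : 0 <= lo * lc * (woc - 1) by rewrite !mulr_ge0 // subr_ge0.
  by have := mulr_gt0 loc loc; clear; lra.
have Nv : N <= hform v v.
  by rewrite vv /N lerD2l -!mulrA ler_pM2l // !ler_wpM2l.
have NE : N = la ^+ 2 + lb ^+ 2 + 2 * la * lb * wab.
  transitivity (la * (lo * woa + lc * wac) + lb * (lo * wob + lc * wcb)); last first.
    by rewrite e3 e4; ring.
  transitivity (lo * (lo + lc * woc) + lc * (lo * woc + lc)); first by rewrite /N; ring.
  by rewrite e1 e2; ring.
have vp : 0 < hform v v by apply: lt_le_trans Nv.
have va : hform v (sval a) <= la + lb * wab.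
  by rewrite vz -e3 lerD // ler_wpM2l // hdotC.
have vb : hform v (sval b) <= la * wab + lb.
  by rewrite vz -e4 lerD // ler_wpM2l.
have vpos z : 0 < hform v (sval z).
  rewrite vz; have := ler_wpM2l lo0 (hdot_ge1 o z); have := ler_wpM2l lc0 (hdot_ge1 c z).
  by move: loc; clear; lra.
(* If [la] or [lb] vanishes, the square of [y] does not see [hdot a b]. Equality in the reversed
   Cauchy-Schwarz inequality then identifies [v] with [l] times [a'], and the Gram determinant gives
   its product with [b']. *)
have degenerate a' b' (l : R) : 0 < l -> N = l ^+ 2 -> hform v (sval a') <= l ->
    hform v (sval b') <= l * wab -> hdot a' b' <= wab.
  move=> l0 Nl va' vb'; have := vpos a'; have := vpos b'.
  have := hform_gram v (sval a') (sval b').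
  rewrite -/(hdot a' a') -/(hdot b' b') -/(hdot a' b') !hdotxx.
  have := hform_reversed_CauchySchwarz (sval a') vp; rewrite -/(hdot a' a') hdotxx mulr1.
  have := hdot_ge1 a' b'; move: va' vb' Nv; rewrite Nl.
  move: (hform v v) (hform v (sval a')) (hform v (sval b')) (hdot a' b') => V x y t.
  move=> xl yl lV t1 Vx g y0 x0.
  have ex : x = l.
    apply/eqP; rewrite eq_le xl /= -ler_sqr ?nnegrE; [|exact: ltW|exact: ltW].
    exact: le_trans Vx.
  have eV : V = l ^+ 2 by apply/eqP; rewrite eq_le lV andbT -ex.
  have : (y - l * t) ^+ 2 <= 0 by move: g; rewrite ex eV; clear; lra.
  move=> h; have : y - l * t = 0 by apply/eqP; rewrite -sqrf_eq0 eq_le h sqr_ge0.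
  by move=> e; rewrite -(ler_pM2l l0); move: e yl; clear; lra.
have [lb1|lb1] := eqVneq lb 0.
  have la1 : 0 < la by move: lab; rewrite lb1 addr0.
  apply: (degenerate a b la) => //; first by rewrite NE lb1; ring.
    by move: va; rewrite lb1 mul0r addr0.
  by move: vb; rewrite lb1 addr0.
have [la1|la1] := eqVneq la 0.
  have lb2 : 0 < lb by move: lab; rewrite la1 add0r.
  rewrite hdotC; apply: (degenerate b a lb) => //; first by rewrite NE la1; ring.
    by move: vb; rewrite la1 mul0r add0r.
  by move: va; rewrite la1 add0r.
have ll : 0 < la * lb by rewrite mulr_gt0 // lt0r ?la1 ?lb1.
pose y := la *: sval a + lb *: sval b.
have yy : hform y y = la ^+ 2 + lb ^+ 2 + 2 * la * lb * hdot a b.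
  rewrite /y !(hformDl, hformZl, hformDr, hformZr).
  by rewrite -/(hdot a a) -/(hdot b b) -/(hdot a b) -/(hdot b a) !hdotxx (hdotC b a); ring.
have vy : hform v y <= N.
  rewrite /y hformDr !hformZr NE.
  by have := ler_wpM2l la0 va; have := ler_wpM2l lb0 vb; clear; lra.
have vy0 : 0 <= hform v y.
  by rewrite /y hformDr !hformZr addr_ge0 // mulr_ge0 // ltW.
have := hform_reversed_CauchySchwarz y vp => rcs.
have yN : hform y y <= N.
  rewrite leNgt; apply/negP => Ny.
  have : hform v y ^+ 2 <= N ^+ 2 by rewrite ler_sqr ?nnegrE // ltW.
  have : N * N < hform v v * hform y y.
    by rewrite (lt_le_trans (y := N * hform y y)) ?ltr_pM2l // ler_wpM2r // ltW // (lt_trans N0).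
  by move: rcs; clear; lra.
by rewrite -(ler_pM2l ll); move: yN; rewrite yy NE; clear; lra.
Qed.

Lemma hyp_between a b (x y : R) : 0 < x -> 0 <= y -> hyp_dist a b = x + y ->
  exists2 p, hyp_dist p a = x /\ hyp_dist p b = y &
    forall z, sinh (x + y) * (hdot p z - 1) =
      sinh y * (hdot a z - 1) + sinh x * (hdot b z - 1)
      - (sinh y * (cosh x - 1) + sinh x * (cosh y - 1)).
Proof.
move=> x0 y0 dab; pose s := sinh (x + y).
have s0 : 0 < s by apply: sinh_gt0; rewrite ltr_wpDr.
have sab : hdot a b = cosh (x + y) by rewrite -dab cosh_hyp_dist.
pose w := (sinh y / s) *: sval a + (sinh x / s) *: sval b.
have sn : s != 0 by rewrite gt_eqF.
have wz z : hform w (sval z) = (sinh y * hdot a z + sinh x * hdot b z) / s.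
  by rewrite /w !hformDl !hformZl /hdot; field.
have wa : hform w (sval a) = cosh x.
  rewrite wz hdotxx (hdotC b a) sab; apply: (mulIf sn); rewrite divfK //.
  rewrite /s coshD sinhD; apply: subr0_eq.
  transitivity (sinh y * (1 - (cosh x ^+ 2 - sinh x ^+ 2))); first by ring.
  by rewrite cosh2sinh2 subrr mulr0.
have wb : hform w (sval b) = cosh y.
  rewrite wz hdotxx sab; apply: (mulIf sn); rewrite divfK //.
  rewrite /s coshD sinhD; apply: subr0_eq.
  transitivity (sinh x * (1 - (cosh y ^+ 2 - sinh y ^+ 2))); first by ring.
  by rewrite cosh2sinh2 subrr mulr0.
have w1 : (lorentz w w == -1) && (0 < w 0 0).
  apply/andP; split.
    rewrite -eqr_opp opprK -/(hform w w).
    have -> : hform w w = sinh y / s * hform w (sval a) + sinh x / s * hform w (sval b).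
      by rewrite {2}/w hformDr !hformZr.
    rewrite wa wb; apply/eqP/(mulIf sn).
    rewrite mul1r; transitivity (sinh y * cosh x + sinh x * cosh y); first by field.
    by rewrite /s sinhD; ring.
  have -> : w 0 0 = crd w 0 by rewrite /crd; congr (w 0 _); apply/val_inj; rewrite /= inordK.
  rewrite crdD !crdZ; apply: ltr_wpDl.
    by apply: mulr_ge0; [exact: divr_ge0 (sinh_ge0 y0) (ltW s0)|exact/ltW/crd0_gt0].
  by apply: mulr_gt0; [exact: divr_gt0 (sinh_gt0 x0) s0|exact: crd0_gt0].
pose p : hyperboloid2 R := exist _ w w1.
exists p; last first.
  move=> z; rewrite {1}/hdot /= wz -/s mulrBr mulr1 mulrCA divff // mulr1.
  by rewrite /s sinhD; ring.
split; apply: cosh_inj; rewrite ?hyp_dist_ge0 ?cosh_hyp_dist //; exact: ltW.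
Qed.

Definition hyperbolic_geometry (H : R) : plane_geometry R.
Proof.
refine (@PlaneGeometry R (hyperboloid2 R) hyp_dist (-1) (fun x => cosh x - 1) sinh H hyp_polar
  _ _ _ _ _ _ _ _ _ _ _ _ _ _ _ _ _).
- by rewrite cosh0 subrr.
- by move=> x; rewrite coshN.
- exact: sinhN.
- by move=> x y; rewrite coshD; ring.
- by move=> x y; rewrite sinhD; ring.
- move=> x; rewrite [LHS](_ : _ = cosh x ^+ 2 - 1); first by ring.
  by rewrite -(cosh2sinh2 x); ring.
- by move=> x y x0 xy _; rewrite ltrD2r cosh_lt.
- move=> x; apply: cvgB; last exact: cvg_cst.
  apply: cvgMl; apply: cvgD; first exact: continuous_expR.
  by apply: (@continuous_comp _ _ _ -%R expR); [exact: opp_continuous|exact: continuous_expR].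
- by move=> x x0 _; apply: sinh_gt0.
- by move=> a b; rewrite /hyp_dist hdotC.
- by move=> a; apply: cosh_inj; rewrite ?hyp_dist_ge0 // cosh_hyp_dist hdotxx cosh0.
- exact: hyp_triangle.
- by move=> a b c e; rewrite lerD2r cosh_le // hyp_dist_ge0.
- move=> r phi psi r0 _; apply: cosh_inj; rewrite ?hyp_dist_ge0 //.
  by rewrite cosh_hyp_dist hdot_polar cosh0 sinh0 !mul0r subr0 mul1r.
- by move=> r r' phi psi _ _ _ _; rewrite cosh_hyp_dist hdot_polar coshD coshN sinhN; ring.
- move=> o a c b qoa qoc qob qac qcb qab lo la lc lb m lo0 la0 lc0 lb0 lab loc qoc0 qab0.
  rewrite !cosh_hyp_dist => e0 e1 e2 e3 e4; rewrite !lerBlDr lerBrDr => h1 h2 h3 h4 h5.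
  apply: (hyp_tensegrity lo0 la0 lc0 lb0 lab loc _ _ _ _ _ _ h1 h2 h3 h4 h5).
  + by rewrite lerDr.
  + by rewrite lerDr.
  + by move: e0 e1; clear; lra.
  + by move: e0 e2; clear; lra.
  + by move: e0 e3; clear; lra.
  + by move: e0 e4; clear; lra.
- move=> a b x y x0 y0 _ dab; have [p pab pz] := hyp_between x0 y0 dab.
  by exists p => // z; rewrite !cosh_hyp_dist pz.
Defined.

End Hyperbolic.

(** * Scaling and cyclic indices *)

(** Target and diameter are parameters, so that the case distinction on the curvature is made only
    in the final theorem. *)
Definition cycl_in (R : realType) (n : nat) (D : distance_space R) (dm : \bar R)
    (X : metricType R) : Prop :=
  forall f : 'Z_n -> X,
    ((\sum_(i : 'Z_n) mdist (f i) (f (i + 1)%R))%R%:E < 2%:E * dm)%E ->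
    exists g : 'Z_n -> D,
      (forall i : 'Z_n, sdist (g i) (g (i + 1)) <= mdist (f i) (f (i + 1))) /\
      (forall i j : 'Z_n, j <> i + 1 -> i <> j + 1 ->
         mdist (f i) (f j) <= sdist (g i) (g j)).

Section Transfer.
Variables (R : realType) (X : metricType R).

Lemma inordS m i : (i < m.+1)%N -> (inord i : 'Z_m.+2) + 1 = inord i.+1.
Proof.
move=> im; apply/val_inj; rewrite /= !inordK ?ltnS //; last exact: leqW.
by rewrite modn_small ?modn_small ?addn1 ?ltnS //; lia.
Qed.

Lemma inord_last m : (inord m.+1 : 'Z_m.+2) + 1 = inord 0.
Proof.
apply/val_inj; rewrite /= !inordK // [(1 %% _)%N]modn_small // addn1 modnn.
by [].
Qed.

Lemma sum_Z4 (F : 'Z_4 -> R) :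
  \sum_i F i = F (inord 0) + F (inord 1) + F (inord 2) + F (inord 3).
Proof.
rewrite !big_ord_recl big_ord0 addr0 !addrA.
by congr (F _ + F _ + F _ + F _); apply/val_inj; rewrite /= inordK.
Qed.

Lemma cycl_in_comparison (D : distance_space R) dm t L (f : nat -> X) (G : plane_geometry R)
    (from : D -> G) i j k l :
  0 < t -> cycl_in 4 D dm X -> (L%:E < 2%:E * dm)%E ->
  (forall u v, pdist (from u) (from v) = t * sdist u v) ->
  mdist (f i) (f j) + mdist (f j) (f k) + mdist (f k) (f l) + mdist (f l) (f i) <= L ->
  comparison G (fun i j => t * mdist (f i) (f j)) i j k l.
Proof.
move=> t0 X4 Ldm fromP le.
pose s := [:: f i; f j; f k; f l].
pose f4 (a : 'Z_4) := nth (f i) s a.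
have e0 : (inord 0 : 'Z_4) + 1 = inord 1 by apply: inordS.
have e1 : (inord 1 : 'Z_4) + 1 = inord 2 by apply: inordS.
have e2 : (inord 2 : 'Z_4) + 1 = inord 3 by apply: inordS.
have e3 : (inord 3 : 'Z_4) + 1 = inord 0 by apply: inord_last.
have f0 : f4 (inord 0) = f i by rewrite /f4 inordK.
have f1 : f4 (inord 1) = f j by rewrite /f4 inordK.
have f2 : f4 (inord 2) = f k by rewrite /f4 inordK.
have f3 : f4 (inord 3) = f l by rewrite /f4 inordK.
have [|g [gs gd]] := X4 f4.
  apply: le_lt_trans Ldm; rewrite lee_fin; apply: le_trans le.
  by rewrite sum_Z4 e0 e1 e2 e3 f0 f1 f2 f3.
have n02 : (inord 2 : 'Z_4) <> inord 1 by move=> /(congr1 val); rewrite /= !inordK.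
have n03 : (inord 0 : 'Z_4) <> inord 3 by move=> /(congr1 val); rewrite /= !inordK.
have n13 : (inord 3 : 'Z_4) <> inord 2 by move=> /(congr1 val); rewrite /= !inordK.
have n10 : (inord 1 : 'Z_4) <> inord 0 by move=> /(congr1 val); rewrite /= !inordK.
exists (from (g (inord 0))), (from (g (inord 1))), (from (g (inord 2))), (from (g (inord 3))).
have := gs (inord 0); have := gs (inord 1); have := gs (inord 2); have := gs (inord 3).
rewrite e0 e1 e2 e3 f0 f1 f2 f3 => h3 h2 h1 h0.
have := gd (inord 0) (inord 2); have := gd (inord 1) (inord 3).
rewrite e0 e1 e2 e3 f0 f1 f2 f3 => /(_ n13 n10) h13 /(_ n02 n03) h02.
split; last split; rewrite fromP ler_pM2l //.
by rewrite (metric_sym (f i)) -(ler_pM2l t0) -fromP pdistC fromP ler_pM2l.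
Qed.

Lemma cycl_in_unfold (D : distance_space R) dm t (G : plane_geometry R)
    (to : G -> D) (from : D -> G) m (f : 'Z_m.+3 -> X) :
  0 < t -> cycl_in 4 D dm X ->
  (forall a b, sdist (to a) (to b) = pdist a b / t) ->
  (forall u v, pdist (from u) (from v) = t * sdist u v) ->
  ((\sum_(i : 'Z_m.+3) mdist (f i) (f (i + 1)%R))%R%:E < 2%:E * dm)%E ->
  t * (\sum_(i : 'Z_m.+3) mdist (f i) (f (i + 1)%R)) < 2 * hlen G ->
  exists g : 'Z_m.+3 -> D,
    (forall i, sdist (g i) (g (i + 1)) <= mdist (f i) (f (i + 1))) /\
    (forall i j, j <> i + 1 -> i <> j + 1 -> mdist (f i) (f j) <= sdist (g i) (g j)).
Proof.
move=> t0 X4 toP fromP Ldm LH.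
pose F (i : nat) := f (inord i : 'Z_m.+3); pose y i := \sum_(k < i) mdist (F k) (F k.+1).
have sumE : \sum_(i : 'Z_m.+3) mdist (f i) (f (i + 1)) = y m.+2 + mdist (F m.+2) (F 0%N).
  rewrite big_ord_recr /=; congr (_ + _).
    apply: eq_bigr => i _; rewrite /F -inordS; last exact: ltn_ord.
    by congr (mdist (f _) (f (_ + 1))); apply/val_inj; rewrite /= inordK // leqW.
  rewrite /F -inord_last.
  by congr (mdist (f _) (f (_ + 1))); apply/val_inj; rewrite /= inordK.
rewrite sumE in Ldm LH.
have yS i : y i.+1 = y i + mdist (F i) (F i.+1) by rewrite /y big_ord_recr.
have y0 : y 0%N = 0 by rewrite /y big_ord0.
have yle i j : (i <= j)%N -> mdist (F i) (F j) <= y j - y i.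
  elim: j => [|j IH]; first by rewrite leqn0 => /eqP->; rewrite mdistxx subrr.
  rewrite leq_eqVlt => /orP[/eqP->|/IH h]; first by rewrite mdistxx subrr.
  by apply: le_trans (metric_triangle _ (F j) _) _; rewrite yS; move: h; clear; lra.
have P : polygon G m.+2 (fun i j => t * mdist (F i) (F j)) (fun i => t * y i).
  split.
  - by rewrite y0 mulr0.
  - by move=> i _; rewrite yS mulrDr.
  - by rewrite -mulrDr (metric_sym (F 0%N)).
  - by move=> i _; rewrite mdistxx mulr0.
  - move=> i k j _ _ _; rewrite -!mulrDr !ler_pM2l //; split.
    + exact: metric_triangle.
    + by rewrite (metric_sym (F k) (F j)); exact: metric_triangle.
    + by rewrite (metric_sym (F i) (F k)); exact: metric_triangle.
  - move=> i j k l ij jk kl lN.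
    (* The quadrilateral is no longer than the polygon: each side is at most the arc it cuts off,
       the last one the arc through the closing side. *)
    apply: (cycl_in_comparison t0 X4 Ldm fromP).
    have := yle _ _ (ltnW ij); have := yle _ _ (ltnW jk); have := yle _ _ (ltnW kl).
    have := yle _ _ lN; have := yle _ _ (leq0n i).
    have := metric_triangle (F l) (F 0%N) (F i).
    have := metric_triangle (F l) (F m.+2) (F 0%N).
    by have := y0; clear; lra.
have [g [g1 g2 g3]] := polygon_unfolds P.
have tn : t != 0 by rewrite gt_eqF.
have fE (i : 'Z_m.+3) : f i = F i by rewrite /F; congr f; apply/val_inj; rewrite /= inordK.
have iS (i : 'Z_m.+3) : (i < m.+2)%N -> i + 1 = inord i.+1 :> 'Z_m.+3.
  by move=> im; rewrite -inordS //; congr (_ + 1); apply/val_inj; rewrite /= inordK.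
have i0 (i : 'Z_m.+3) : i = m.+2 :> nat -> i + 1 = inord 0 :> 'Z_m.+3.
  by move=> im; rewrite -inord_last; congr (_ + 1); apply/val_inj; rewrite /= inordK.
exists (fun i => to (g i)); split.
  move=> i; rewrite toP ler_pdivrMr // mulrC; have := ltn_ord i.
  rewrite ltnS leq_eqVlt => /orP[/eqP e|im].
    by rewrite i0 // e inordK // pdistC g2 -/(F 0%N) fE e metric_sym.
  by rewrite iS // inordK // g1 // -/(F i.+1) fE.
move=> i j _ _; rewrite toP ler_pdivlMr // mulrC !fE.
case: (ltngtP i j) => ij; first by apply: g3 => //; rewrite -ltnS ltn_ord.
  by rewrite metric_sym pdistC; apply: g3 => //; rewrite -ltnS ltn_ord.
by rewrite ij mdistxx mulr0 pdist_ge0.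
Qed.

End Transfer.

Theorem theorem1p6 (R : realType) (kappa : R) (X : metricType R) :
  cycl 4 kappa X -> forall n : nat, (5 <= n)%N -> cycl n kappa X.
Proof.
move=> X4 [|[|[|m]]] // _ f; rewrite /cycl in X4 *.
move: X4; rewrite /model_space /model_diam; case: ifP => [k0|_].
  have t0 : 0 < Num.sqrt kappa by rewrite sqrtr_gt0.
  move=> X4 h.
  apply: (@cycl_in_unfold R X (scaled_sphere kappa) (pi / Num.sqrt kappa)%:E _
    (spherical_geometry R) id id m f t0 X4 _ _ h) => //.
  - by move=> u v; rewrite /= mulrC divfK // gt_eqF.
  - by move: h; rewrite -EFinM lte_fin mulrA ltr_pdivlMr // mulrC.
pose L := \sum_(i : 'Z_m.+3) mdist (f i) (f (i + 1)).
have L0 : 0 <= L by apply: sumr_ge0 => i _; exact: mdist_ge0.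
have [k0|k0] := ltrP kappa 0 => X4 h.
  have t0 : 0 < Num.sqrt (- kappa) by rewrite sqrtr_gt0 oppr_gt0.
  (* With infinite diameter any [hlen] above half the scaled perimeter serves; the [+ 1] keeps the
     bound strict when [L = 0]. The plane is treated in the same way below. *)
  apply: (@cycl_in_unfold R X (scaled_hyperbolic kappa) +oo%E _
    (hyperbolic_geometry (Num.sqrt (- kappa) * L + 1)) id id m f t0 X4 _ _ h) => //.
  - by move=> u v; rewrite /= mulrC divfK // gt_eqF.
  - have := mulr_ge0 (ltW t0) L0; rewrite /= -/L; clear; lra.
apply: (@cycl_in_unfold R X (euclidean_plane R) +oo%E _ (planar_geometry (L + 1))
  id id m f ltr01 X4 _ _ h) => //.
- by move=> a b; rewrite divr1.
- by move=> u v; rewrite mul1r.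
- by rewrite /= -/L; move: L0; clear; lra.
Qed.
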